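(* Let $T>0$, $h\in(0,1]$, and let $p\ge2$ be an integer, $\gamma\in(0,1/p]$, and $V\in\mathcal V^p_\gamma$. Let $\{\bar X_k\}$ be the scheme $$\bar X_{k+1}=\bar X_k+b^h(t_k,\bar X_k)h+\sigma^h(t_k,\bar X_k)\Delta W_{k+1},\qquad \bar X_0=X_0,$$ on $[0,T]$. Suppose there is $\rho>0$ such that $\mathcal L^hV(x)\le\rho V(x)$ for all $t\in[0,T]$, $x\in\mathbb R^d$, and there is $\mu>0$ such that $$|b^h(t,x)|\,h^{\beta_1}\vee\|\sigma^h(t,x)\|\,h^{\beta_2}\le\mu(1+V(x))^\gamma,\qquad\forall t\in[0,T],\ x\in\mathbb R^d,$$ where $\beta_1\le 1/2$ and $\beta_2\le \frac12-\frac1{p\wedge4}$. Then there exists $\tilde\rho=\tilde\rho(\mu)$ such that $$\mathbb E V(\bar X_k)\le e^{(\rho+\tilde\rho)T}\,\mathbb E(1+V(X_0)),\qquad\forall\,0\le k\le\lfloor T/h\rfloor.$$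
   Context: $(\Omega,\mathcal F,\mathbb P)$ is a complete probability space with right-continuous filtration $(\mathcal F_t)$; $W$ is an $m$-dimensional $(\mathcal F_t)$-Wiener process; $X_0$ is an $\mathcal F_0$-measurable $\mathbb R^d$-valued random variable; $t_k=kh$, $\Delta W_{k+1}=W_{t_{k+1}}-W_{t_k}$. The tamed coefficients $b^h:[0,T]\times\mathbb R^d\to\mathbb R^d$ and $\sigma^h:[0,T]\times\mathbb R^d\to\mathbb R^{d\times m}$ are measurable functions; $\|\cdot\|$ is the Hilbert–Schmidt norm; $a\vee b=\max(a,b)$, $a\wedge b=\min(a,b)$. For integers $p\ge2$ and $0<\gamma\le 1/p$, $\mathcal V^p_\gamma$ is the set of $V\in\mathcal C^{p+1}(\mathbb R^d)$ with $V\ge0$, $V(x)=0$ iff $x=0$, and for which there is $c>0$ with $\|V^{(s)}(x)\|_{HS}\le c(1+V(x))^{1-s\gamma}$ for all $x\in\mathbb R^d$ and all $s\le p$, where $V^{(s)}$ is the $s$-th derivative tensor. $\mathcal L^hV(x)=\langle\nabla V(x),b^h(t,x)\rangle+\frac12\mathrm{tr}\left[V^{(2)}(x)\sigma^h(t,x)\sigma^h(t,x)^\top\right]$, with the dependence on $t$ suppressed in the notation. The notation $\tilde\rho(\mu)$ means that $\tilde\rho$ depends on $\mu$ (and on $V,p,\gamma,d,m$) but not on $h$ or $k$. *)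

(* Defs.v *)
From HB Require Import structures.
From mathcomp Require Import all_boot all_order all_algebra.
From mathcomp Require Import all_classical all_reals all_analysis.

Set Implicit Arguments.
Unset Strict Implicit.
Unset Printing Implicit Defensive.

Import Order.TTheory GRing.Theory Num.Theory.
Import numFieldNormedType.Exports.

Local Open Scope classical_set_scope.
Local Open Scope ring_scope.

(* R^d is 'cV[R]_d.  The library norm `|_| on matrices is the sup norm; hs_norm
   is the Hilbert-Schmidt norm, hence the Euclidean norm on column vectors. *)
Definition hs_norm (R : realType) (m n : nat) (A : 'M[R]_(m, n)) : R :=
  Num.sqrt (\sum_i \sum_j A i j ^+ 2).

Section smooth_functions.
Variables (R : realType) (d : nat).
Implicit Types (V : 'cV[R]_d -> R) (x : 'cV[R]_d).

Definition partial V (i : 'I_d) : 'cV[R]_d -> R :=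
  fun x => 'D_(delta_mx i 0) V x.

(* partials V [:: i1; ...; is] is the partial derivative of V along
   i1, ..., is, the derivative along i1 being taken last. *)
Definition partials V (I : seq 'I_d) : 'cV[R]_d -> R :=
  foldr (fun i g => partial g i) V I.

(* 'D_v g x is a total function, so the existence of each partial derivative
   has to be required separately. *)
Definition class_C (n : nat) V : Prop :=
  forall I : seq 'I_d, (size I <= n)%N ->
    continuous (partials V I) /\
    ((size I < n)%N ->
      forall (i : 'I_d) x, derivable (partials V I) x (delta_mx i 0)).

(* The s-th derivative tensor at x has the d ^ s entries partials V I x,
   for I : s.-tuple 'I_d. *)
Definition hs_norm_deriv V (s : nat) x : R :=
  Num.sqrt (\sum_(I : s.-tuple 'I_d) partials V I x ^+ 2).

Definition lyapunov_class (p : nat) (gamma : R) V : Prop :=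
  [/\ class_C p.+1 V,
      forall x, 0 <= V x,
      forall x, V x = 0 <-> x = 0
    & exists2 c : R, 0 < c &
        forall x (s : nat), (s <= p)%N ->
          hs_norm_deriv V s x <= c * (1 + V x) `^ (1 - s%:R * gamma)].

Definition gradient V x : 'cV[R]_d := \col_i partials V [:: i] x.

Definition hessian V x : 'M[R]_d := \matrix_(i, j) partials V [:: i; j] x.

Definition generator (m : nat) (b : R -> 'cV[R]_d -> 'cV[R]_d)
    (sigma : R -> 'cV[R]_d -> 'M[R]_(d, m)) V (t : R) x : R :=
  \sum_i gradient V x i 0 * b t x i 0 +
  2^-1 * \tr (hessian V x *m sigma t x *m (sigma t x)^T).

End smooth_functions.

(* Matrices have no canonical measurable structure in the library. *)
Definition borel (T : ptopologicalType) := g_sigma_algebraType (@open T).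

(* Measurability on [0, T] * R^d; on the product of R, with its canonical
   measurable structure, and of borel 'cV[R]_d the library puts the product
   sigma-algebra. *)
Definition coef_measurable (R : realType) (d : nat) (T : R)
    (U : ptopologicalType) (f : R -> 'cV[R]_d -> U) : Prop :=
  measurable_fun ([set z | 0 <= z.1 <= T] : set (R * borel 'cV[R]_d))
    (fun z => f z.1 z.2 : borel U).

Section stochastic.
Context (R : realType) (disp : measure_display) (Omega : measurableType disp).
Implicit Types (P : probability Omega R) (F : R -> set (set Omega)).

(* Time is [0, +oo[; the values of F and of the processes at negative times
   are irrelevant. *)
Definition filtration F : Prop :=
  [/\ forall t, 0 <= t -> sigma_algebra setT (F t),
      forall t, 0 <= t -> F t `<=` @measurable _ Omega
    & forall s t, 0 <= s -> s <= t -> F s `<=` F t].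

Definition right_continuous_filtration F : Prop :=
  forall t, 0 <= t -> F t = \bigcap_(u in [set u | t < u]) F u.

Definition measurable_wrt (G : set (set Omega)) (T : ptopologicalType)
    (X : Omega -> T) : Prop :=
  forall B : set (borel T), measurable B -> G (X @^-1` B).

Definition increment (m : nat) (W : R -> Omega -> 'cV[R]_m) (s t : R)
    : Omega -> 'cV[R]_m := fun w => W t w - W s w.

Definition wiener_process P F (m : nat) (W : R -> Omega -> 'cV[R]_m) : Prop :=
  [/\ forall t, 0 <= t -> measurable_wrt (F t) (W t),
      {ae P, forall w, W 0 w = 0},
      {ae P, forall w, {within `[0, +oo[, continuous (W ^~ w)}},
      forall s t : R, 0 <= s -> s < t ->
        forall (A : set Omega) (B : set (borel 'cV[R]_m)),
          F s A -> measurable B ->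
          (P (A `&` increment W s t @^-1` B) =
           P A * P (increment W s t @^-1` B))%E
      (* the law of W t - W s is N(0, (t - s) I); the second parameter of
         normal_prob is the standard deviation *)
    & forall s t : R, 0 <= s -> s < t ->
        forall A : 'I_m -> set R, (forall i, measurable (A i)) ->
          P [set w | forall i, A i (increment W s t w i 0)] =
          (\prod_i normal_prob 0 (Num.sqrt (t - s)) (A i))%E].

Fixpoint tamed_scheme (d m : nat) (b : R -> 'cV[R]_d -> 'cV[R]_d)
    (sigma : R -> 'cV[R]_d -> 'M[R]_(d, m)) (h : R)
    (W : R -> Omega -> 'cV[R]_m) (X0 : Omega -> 'cV[R]_d) (k : nat)
    : Omega -> 'cV[R]_d :=
  if k is k'.+1 then fun w =>
    let x := tamed_scheme b sigma h W X0 k' w in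
    x + h *: b (k'%:R * h) x
      + sigma (k'%:R * h) x *m increment W (k'%:R * h) (k'.+1%:R * h) w
  else X0.

End stochastic.

(* Main.v *)
Require Import Defs.
From HB Require Import structures.
From mathcomp Require Import all_boot all_order all_algebra.
From mathcomp Require Import all_classical all_reals all_analysis.
From mathcomp Require Import measurable_realfun ring lra zify.

Set Implicit Arguments.
Unset Strict Implicit.
Unset Printing Implicit Defensive.

Import Order.TTheory GRing.Theory Num.Theory.
Import numFieldNormedType.Exports.

Local Open Scope classical_set_scope.
Local Open Scope ring_scope.

(* One step of the scheme, started from a fixed point x, is x + w + v with
   w = h b and v = sigma Delta W.  The growth condition gives |w| <= h^(1/2) L and
   |v| <= h^(1/q) |zeta| L up to constants, where L = (1 + V(x))^gamma, q = min(p, 4)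
   and zeta is standard Gaussian.  Since (1 + V)^gamma is Lipschitz, 1 + V grows at
   most by a polynomial factor in |zeta| along the step, so a derivative of V of
   order s costs (1 + V(x))^(1 - s gamma), which s factors L compensate.  Replacing
   v by -v does not change the expectation, so only the even terms of the expansion
   in v matter: the order 2 term has mean h tr(V'' sigma sigma^T), its displacement
   from x + w to x is of order h^(1/2 + 2/q) <= h when q >= 3, and the remainder of
   order q is of order h.  Hence E(1 + V) is multiplied by at most
   1 + (rho + C) h at each step. *)

(** * Taylor expansion along a line *)

(** The cap at order 4 is forced: for q > 4 the even term of order 4 in v would be of size h^(4/q),
    larger than h, and symmetry would not remove it. For q = 2 the term of order 2 in v is itself of
    order h, so it is treated as an error. Since the final constant may not depend on h, the
    increment of W enters the estimates only after division by its standard deviation h^(1/2): the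
    moments of the quotient are bounded independently of h. For the same reason every constant is
    fixed before the step size, the coefficients and the probability space are introduced. The mean
    of V(X_0) may be infinite, so V along the scheme is handled through integrals of nonnegative
    functions with values in the extended reals. Symmetrising pointwise, before integrating, also
    means that no term of odd order in v ever has to be integrated. *)

Section directional_derivatives.
Variables (R : realType) (d : nat).
Implicit Types (f V : 'cV[R]_d -> R) (x y u v z : 'cV[R]_d).

Lemma is_derive_line f z v (t : R) :
  derivable f (z + t *: v) v ->
  is_derive t 1 (fun s : R => f (z + s *: v)) ('D_v f (z + t *: v)).
Proof.
have quotE : (fun s : R => s^-1 *: (f (z + (s *: 1 + t) *: v) - f (z + t *: v))) =
    (fun s : R => s^-1 *: (f (s *: v + (z + t *: v)) - f (z + t *: v))).
  apply/funext => s; congr (_ *: (f _ - _)).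
  by rewrite scalerDl [s *: 1]mulr1 addrCA.
move=> fv; split.
  by rewrite /derivable quotE.
by rewrite /derive quotE.
Qed.

Lemma is_derive1_continuous (g : R -> R) (s dg : R) :
  is_derive s 1 g dg -> {for s, continuous g}.
Proof.
by move=> [dg' _]; apply: differentiable_continuous; exact/derivable1_diffP.
Qed.

(** The intermediate point is located by its distance to a, so that a and b may come in either
    order: coordinates of a displacement have arbitrary signs. *)
Lemma mean_value (g dg : R -> R) (a b : R) :
  (forall s : R, is_derive s 1 g (dg s)) ->
  exists2 c, `|c - a| <= `|b - a| & g b - g a = dg c * (b - a).
Proof.
move=> gdg.
have gc (A : set R) : {within A, continuous g}.
  apply: continuous_subspaceT => s; exact: is_derive1_continuous (gdg s).
have [ab|/ltW ba] := leP a b.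
  have [c /[!in_itv]/= /andP[ac cb] ->] :=
    MVT_segment ab (fun s _ => gdg s) (gc _).
  by exists c => //; rewrite !ger0_norm ?subr_ge0// lerD2r.
have [c /[!in_itv]/= /andP[bc ca] e] := MVT_segment ba (fun s _ => gdg s) (gc _).
exists c; last by rewrite -opprB e -mulrN opprB.
by rewrite !ler0_norm ?subr_le0// !opprB lerD2l lerN2.
Qed.

(* The increment is split into d increments along the coordinate axes. *)
Lemma coordinate_increments f (e r : R) x v :
  (forall i z, derivable f z (delta_mx i 0)) ->
  (forall u, (forall i, `|u i 0| <= r) ->
    forall i, `|partial f i (x + u) - partial f i x| <= e) ->
  (forall i, `|v i 0| <= r) ->
  `|f (x + v) - f x - \sum_i v i 0 * partial f i x| <= e * \sum_i `|v i 0|.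
Proof.
move=> df cf vr.
have r0 i : 0 <= r := le_trans (normr_ge0 _) (vr i).
(* [w k] keeps the first k coordinates of v. All points between [w i] and [w i.+1] have entries
   bounded by r, so the hypothesis on the partial derivatives applies at the mean value point. *)
pose w k : 'cV[R]_d := \col_i (if (i < k)%N then v i 0 else 0).
have wS (i : 'I_d) : w i.+1 = w i + v i 0 *: delta_mx i 0.
  apply/matrixP => j l; rewrite ord1 !mxE eqxx andbT ltnS leq_eqVlt.
  have [ji|ji] := eqVneq (j : nat) i.
    have -> : j = i by exact: val_inj.
    by rewrite ltnn eqxx mulr1 add0r.
  have -> : (j == i) = false by apply/negbTE; apply: contra ji => /eqP ->.
  by rewrite mulr0 addr0.
have wd : w d = v by apply/matrixP => j l; rewrite ord1 mxE ltn_ord.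
have w0 : w 0 = 0 by apply/matrixP => j l; rewrite !mxE.
have step (i : 'I_d) :
    `|f (x + w i.+1) - f (x + w i) - v i 0 * partial f i x| <= e * `|v i 0|.
  have [c] := @mean_value (fun s : R => f (x + w i + s *: delta_mx i 0)) _ 0 (v i 0)
    (fun s => is_derive_line (df i (x + w i + s *: delta_mx i 0))).
  rewrite /= scale0r !addr0 !subr0 wS addrA => cv ->.
  rewrite [_ * v i 0]mulrC -mulrBr normrM mulrC ler_wpM2r// -addrA.
  apply: cf => j; rewrite !mxE eqxx andbT.
  case: ltngtP => [ji|ij|/val_inj ->].
  - by rewrite (_ : (j == i) = false) ?mulr0 ?addr0// -val_eqE/= ltn_eqF.
  - by rewrite (_ : (j == i) = false) ?mulr0 ?addr0 ?normr0 ?r0// -val_eqE/= gtn_eqF.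
  - by rewrite eqxx mulr1 add0r (le_trans cv).
have -> : f (x + v) - f x = \sum_(i < d) (f (x + w i.+1) - f (x + w i)).
  rewrite -[in LHS]wd -[in f x](addr0 x) -[in f (x + 0)]w0.
  by rewrite -(telescope_sumr (fun k => f (x + w k)) (leq0n d)) big_mkord.
rewrite -sumrB mulr_sumr (le_trans (ler_norm_sum _ _ _))//.
exact: ler_sum.
Qed.

(** Near y the partial derivatives are within e' of their values at y, so [coordinate_increments]
    makes the error of the linear approximation at most e' times the l1 norm of s v, which division
    by s turns into a constant below e. *)
Lemma is_derive_C1 f x v (t : R) :
  (forall i, continuous (partial f i)) ->
  (forall i z, derivable f z (delta_mx i 0)) ->
  is_derive t 1 (fun s : R => f (x + s *: v))
    (\sum_i v i 0 * partial f i (x + t *: v)).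
Proof.
move=> cf df; set y := x + t *: v; set l := \sum_i _.
pose q (s : R) := s^-1 *: (f (x + (s *: 1 + t) *: v) - f (x + t *: v)).
suff ql : q s @[s --> 0^'] --> l.
  by split; [apply/cvg_ex; exists l|exact/cvg_lim].
apply/cvgrPdist_le => e e0.
pose S := \sum_i `|v i 0|; have S0 : 0 <= S by exact: sumr_ge0.
(* The summand 1 covers v = 0, where S vanishes. *)
pose e' := e / (1 + S).
have S1 : 0 < 1 + S by rewrite ltr_wpDr.
have e'0 : 0 < e' by rewrite divr_gt0.
have /nbhs_ballP[r /= r0 hr] : \forall z \near y,
    forall i, `|partial f i z - partial f i y| <= e'.
  apply: (@filter_forall _ _ (fun i z => `|partial f i z - partial f i y| <= e') (nbhs y)) => i.
  by have /cvgrPdist_le/(_ _ e'0) := cf i y;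
    apply: filterS => z; rewrite distrC.
have r20 : 0 < r / 2 by rewrite divr_gt0.
near=> s.
have s0 : s != 0 by near: s; exact: nbhs_dnbhs_neq.
have sr : `|s| * (1 + S) <= r / 2.
  rewrite -ler_pdivlMr//; near: s; apply: dnbhs0_le; exact: divr_gt0.
have -> : l - q s = - (s^-1 * (f (y + s *: v) - f y - \sum_i (s *: v) i 0 * partial f i y)).
  have -> : q s = s^-1 * (f (y + s *: v) - f y).
    rewrite /q; have -> // : x + (s *: 1 + t) *: v = y + s *: v.
    by rewrite scalerDl [s *: 1]mulr1 addrA addrAC.
  have -> : l = s^-1 * \sum_i (s *: v) i 0 * partial f i y.
    rewrite mulr_sumr; apply: eq_bigr => i _.
    by rewrite mxE !mulrA mulVf// mul1r.
  by ring.
rewrite normrN normrM.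
have vr i : `|(s *: v) i 0| <= r / 2.
  rewrite mxE normrM (le_trans _ sr)// ler_wpM2l// (@le_trans _ _ S)//.
    by rewrite /S (bigD1 i)//= lerDl sumr_ge0.
  by rewrite lerDr.
apply: (@le_trans _ _ (`|s^-1| * (e' * \sum_i `|(s *: v) i 0|))).
  rewrite ler_wpM2l//; apply: (@coordinate_increments _ _ (r / 2)) => //.
  move=> u ur i; apply: (hr (y + u)).
  rewrite mx_norm_ball /ball_/= opprD addNKr normrN.
  rewrite (@le_lt_trans _ _ (r / 2))//; last lra.
  have [u0|/mx_norm_neq0[[j k]]] := eqVneq (mx_norm u) 0.
    by rewrite /Num.norm/= u0 ltW.
  by rewrite /Num.norm/= => ->; rewrite ord1; exact: ur.
have -> : \sum_i `|(s *: v) i 0| = `|s| * S.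
  by rewrite mulr_sumr; apply: eq_bigr => i _; rewrite mxE normrM.
rewrite normfV mulrCA mulKf ?normr_eq0//.
rewrite /e' -mulrA ler_piMr ?(ltW e0)// mulrC ler_pdivrMr// mul1r.
by rewrite lerDr.
Unshelve. all: by end_near.
Qed.

Lemma is_derive_exp_sum (a : nat -> R) (n : nat) (s : R) :
  is_derive s 1 (fun t : R => \sum_(j < n.+1) a j * (t ^+ j / j`!%:R))
    (\sum_(j < n) a j.+1 * (s ^+ j / j`!%:R)).
Proof.
elim: n => [|n IHn].
  rewrite big_ord0 (_ : (fun t => _) = cst (a 0%N)); first exact: is_derive_cst.
  by apply/funext => t; rewrite big_ord1 expr0 fact0 divr1 mulr1.
rewrite (_ : (fun t => _) =
  (fun t => \sum_(j < n.+1) a j * (t ^+ j / j`!%:R)) +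
  (a n.+1 / n.+1`!%:R) *: (fun t => t ^+ n.+1)); last first.
  apply/funext => t; rewrite big_ord_recr/= fctE; congr (_ + _).
  by rewrite /= scalrfctE /= mulrCA mulrC.
have -> : \sum_(j < n.+1) a j.+1 * (s ^+ j / j`!%:R) =
    \sum_(j < n) a j.+1 * (s ^+ j / j`!%:R) +
    (a n.+1 / n.+1`!%:R) *: ((n.+1%:R * s ^+ n) *: 1).
  rewrite big_ord_recr/=; congr (_ + _).
  rewrite -[_ *: _]/(_ * _) [_ *: 1]mulr1 factS natrM.
  have n0 : (n.+1%:R : R) != 0 by rewrite pnatr_eq0.
  have f0 : (n`!%:R : R) != 0 by rewrite pnatr_eq0 -lt0n fact_gt0.
  by field; apply/andP; split; rewrite // -natr1 in n0 *.
apply: is_deriveD; apply: is_deriveZ.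
rewrite (_ : (fun t => _) = id ^+ n.+1); first exact: is_deriveX.
by rewrite exprfctE.
Qed.

(** Induction on the shifted family: it bounds [f 1] by the derivative of the claimed polynomial, so
    the difference of the two sides, which vanishes at 0, cannot increase. Only an upper bound on
    the last member is required. *)
Lemma taylor_upper_bound (f : nat -> R -> R) (B : R) (n : nat) :
  (forall j (s : R), (j < n)%N -> is_derive s 1 (f j) (f j.+1 s)) ->
  (forall s : R, 0 <= s <= 1 -> f n s <= B) ->
  forall s : R, 0 <= s <= 1 ->
    f 0%N s <= \sum_(j < n) f j 0 * (s ^+ j / j`!%:R) + B * (s ^+ n / n`!%:R).
Proof.
elim: n f => [|n IHn] f df fB s s01.
  by rewrite big_ord0 add0r expr0 fact0 divr1 mulr1 fB.
have {}IHn := IHn (fun j => f j.+1) (fun j s jn => df j.+1 s jn) fB.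
(* Putting B after the coefficients [f j 0] makes the bound a single exponential sum; its derivative
   is exactly the bound given by the induction hypothesis. *)
pose a j := if (j <= n)%N then f j 0 else B.
have aE m t : (m <= n)%N -> \sum_(j < m.+1) f j 0 * (t ^+ j / j`!%:R) =
    \sum_(j < m.+1) a j * (t ^+ j / j`!%:R).
  move=> mn; apply: eq_bigr => j _.
  by rewrite /a (leq_trans _ mn)// -ltnS.
have PE t : \sum_(j < n.+1) f j 0 * (t ^+ j / j`!%:R) + B * (t ^+ n.+1 / n.+1`!%:R)
   = \sum_(j < n.+2) a j * (t ^+ j / j`!%:R).
  by rewrite [RHS]big_ord_recr/= aE// {3}/a ltnn.
rewrite PE -subr_le0.
have dg (t : R) : is_derive t 1 (f 0%N - (fun t => \sum_(j < n.+2) a j * (t ^+ j / j`!%:R)))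
    (f 1%N t - \sum_(j < n.+1) a j.+1 * (t ^+ j / j`!%:R)).
  by apply: is_deriveB; [exact: df|exact: is_derive_exp_sum].
case/andP: s01 => s0 s1.
have g0 : f 0%N 0 - \sum_(j < n.+2) a j * (0 ^+ j / j`!%:R) = 0.
  rewrite big_ord_recl/= big1 ?addr0 => [|i _].
    by rewrite /a/= expr0 fact0 divr1 mulr1 subrr.
  by rewrite expr0n/= mul0r mulr0.
have [//|c] := MVT_segment s0 (fun t _ => dg t).
  by apply: continuous_subspaceT => t; exact: is_derive1_continuous (dg t).
rewrite !fctE g0 in_itv/= !subr0 => /andP[c0 cs] ->.
rewrite mulr_le0_ge0// subr_le0 (le_trans (IHn c _)) ?c0 ?(le_trans cs)//.
rewrite big_ord_recr/= {2}/a ltnn lerD2r.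
by apply: ler_sum => j _; rewrite /a ltn_ord.
Qed.

(* nested V n I v is the n-th derivative of partials V I in the direction v. *)
Fixpoint nested V (n : nat) (I : seq 'I_d) v x : R :=
  if n is n'.+1 then \sum_i v i 0 * nested V n' (i :: I) v x else partials V I x.

Lemma nestedN V n I v x : nested V n I (- v) x = (-1) ^+ n * nested V n I v x.
Proof.
elim: n I => [|n IHn] I; first by rewrite /= expr0 mul1r.
rewrite /= mulr_sumr; apply: eq_bigr => i _.
by rewrite IHn mxE exprS; ring.
Qed.

Lemma is_derive_nested V N n I x v (t : R) :
  class_C N V -> (size I + n < N)%N ->
  is_derive t 1 (fun s : R => nested V n I v (x + s *: v))
    (nested V n.+1 I v (x + t *: v)).
Proof.
move=> CV; elim: n I => [|n IHn] I sI.
  rewrite addn0 in sI.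
  apply: is_derive_C1 => i.
    by have [] := CV (i :: I) sI.
  by move=> z; have [_ /(_ sI)] := CV I (ltnW sI).
rewrite (_ : (fun s => _) = \sum_i (v i 0 *: (fun s => nested V n (i :: I) v (x + s *: v)))).
  apply: is_derive_sum => i; apply: is_deriveZ.
  by apply: IHn; rewrite /= addSnnS.
by apply/funext => s; rewrite fct_sumE.
Qed.

Lemma nested_dist V n I v x y (a B : R) :
  (forall i, `|v i 0| <= a) -> 0 <= B ->
  (forall J, size J = (n + size I)%N -> `|partials V J y - partials V J x| <= B) ->
  `|nested V n I v y - nested V n I v x| <= (d%:R * a) ^+ n * B.
Proof.
move=> va B0; elim: n I => [|n IHn] I JB; first by rewrite expr0 mul1r JB.
rewrite /= -sumrB (le_trans (ler_norm_sum _ _ _))//.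
apply: (@le_trans _ _ (\sum_(i < d) a * ((d%:R * a) ^+ n * B))).
  apply: ler_sum => i _; rewrite -mulrBr normrM ler_pM//.
  by apply: IHn => J sJ; apply: JB; rewrite sJ addnS.
by rewrite sumr_const card_ord exprS -[leLHS]mulr_natl !mulrA.
Qed.

Lemma nested_bound V n I v x (a B : R) :
  (forall i, `|v i 0| <= a) -> 0 <= B ->
  (forall J, size J = (n + size I)%N -> `|partials V J x| <= B) ->
  `|nested V n I v x| <= (d%:R * a) ^+ n * B.
Proof.
move=> va B0; elim: n I => [|n IHn] I JB; first by rewrite expr0 mul1r JB.
rewrite /= (le_trans (ler_norm_sum _ _ _))//.
apply: (@le_trans _ _ (\sum_(i < d) a * ((d%:R * a) ^+ n * B))).
  apply: ler_sum => i _; rewrite normrM ler_pM//.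
  by apply: IHn => J sJ; apply: JB; rewrite sJ addnS.
by rewrite sumr_const card_ord exprS -[leLHS]mulr_natl !mulrA.
Qed.

Lemma taylor_directional V n x v (B : R) :
  class_C n V ->
  (forall s : R, 0 <= s <= 1 -> nested V n [::] v (x + s *: v) <= B) ->
  V (x + v) <= \sum_(j < n) nested V j [::] v x / j`!%:R + B / n`!%:R.
Proof.
move=> CV VB.
have /(_ 1) := @taylor_upper_bound (fun j s => nested V j [::] v (x + s *: v)) B n
  (fun j s jn => @is_derive_nested V n j [::] x v s CV jn) VB.
rewrite ler01 lexx scale1r => /(_ isT)/le_trans; apply.
rewrite expr1n mul1r lerD2r le_eqVlt; apply/orP; left; apply/eqP.
by apply: eq_bigr => j _; rewrite scale0r addr0 expr1n mul1r.
Qed.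

(* In the symmetrised expansion the terms of odd order cancel. *)
Lemma taylor_symmetric V n x v (B : R) :
  class_C n V ->
  (forall s : R, -1 <= s <= 1 -> `|nested V n [::] v (x + s *: v)| <= B) ->
  V (x + v) + V (x - v) <=
  \sum_(j < n | ~~ odd j) 2 * nested V j [::] v x / j`!%:R + 2 * B / n`!%:R.
Proof.
move=> CV VB.
have h1 : V (x + v) <= \sum_(j < n) nested V j [::] v x / j`!%:R + B / n`!%:R.
  apply: taylor_directional => // s /andP[s0 s1].
  by rewrite (le_trans (ler_norm _))// VB// s1 (le_trans _ s0)// lerN10.
have h2 : V (x - v) <= \sum_(j < n) nested V j [::] (- v) x / j`!%:R + B / n`!%:R.
  apply: taylor_directional => // s /andP[s0 s1].
  rewrite (le_trans (ler_norm _))// nestedN normrM normrX normrN1 expr1n mul1r.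
  by rewrite scalerN -scaleNr VB// lerN2 s1 lerNl (le_trans _ s0)// lerN10.
apply: (le_trans (lerD h1 h2)); rewrite addrACA -big_split/=.
apply: lerD; last by rewrite -mulrDl mulr_natl mulr2n.
rewrite [leRHS]big_mkcond/= le_eqVlt; apply/orP; left; apply/eqP.
apply: eq_bigr => j _; rewrite nestedN -signr_odd.
by case: (odd j); rewrite ?expr0 ?expr1; ring.
Qed.

End directional_derivatives.

(** * Growth of V along one step *)

Section lyapunov_growth.
Variables (R : realType) (d p : nat) (gamma : R) (V : 'cV[R]_d -> R).
Hypotheses (hgamma : 0 < gamma <= p%:R^-1) (hV : lyapunov_class p gamma V).
Implicit Types (x u v w : 'cV[R]_d) (I : seq 'I_d).

Let G x := 1 + V x.

Let gamma_gt0 : 0 < gamma. Proof. by case/andP: hgamma. Qed.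

Let G_ge1 x : 1 <= G x.
Proof. by case: hV => _ V0 _ _; rewrite /G lerDl. Qed.

Let G_gt0 x : 0 < G x. Proof. exact: lt_le_trans (G_ge1 x). Qed.

(** Follows from gamma <= 1/p. Nonnegative exponents make the powers monotone, and exponents at most
    1 do not enlarge a number that is at least 1. *)
Let gammaM s : (s <= p)%N -> 0 <= 1 - s%:R * gamma <= 1.
Proof.
move=> sp; have /andP[_ gp] := hgamma.
rewrite subr_ge0 gerBl mulr_ge0 ?ler0n ?(ltW gamma_gt0)// andbT.
have [->|p0] := posnP s; first by rewrite mul0r.
have pp : 0 < p%:R :> R by rewrite ltr0n (leq_trans p0).
rewrite (@le_trans _ _ (p%:R * p%:R^-1))//; last by rewrite divff// gt_eqF.
by rewrite ler_pM ?ler0n ?(ltW gamma_gt0)// ler_nat.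
Qed.

Lemma partials_le_hs_norm I x : `|partials V I x| <= hs_norm_deriv V (size I) x.
Proof.
rewrite -sqrtr_sqr ler_wsqrtr// (bigD1 (in_tuple I))//= lerDl.
by apply: sumr_ge0 => *; exact: sqr_ge0.
Qed.

Lemma partials_growth : exists2 c : R, 0 < c & forall I x, (size I <= p)%N ->
  `|partials V I x| <= c * G x `^ (1 - (size I)%:R * gamma).
Proof.
have [_ _ _ [c c0 hc]] := hV; exists c => // I x sI.
by rewrite (le_trans (partials_le_hs_norm _ _))// hc.
Qed.

(** The derivative of G^gamma along u is gamma G^(gamma - 1) times that of V, and G^(gamma - 1)
    cancels the growth G^(1 - gamma) of the gradient. *)
Lemma powR_lyapunov_lipschitz (c a : R) x u : 0 <= c -> 0 <= a -> (0 < p)%N ->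
  (forall i y, `|partials V [:: i] y| <= c * G y `^ (1 - gamma)) ->
  (forall i, `|u i 0| <= a) ->
  G (x + u) `^ gamma <= G x `^ gamma + d%:R * a * c.
Proof.
move=> c0 a0 p0 hc ua; have [CV V0 _ _] := hV.
have CV1 : class_C 1 V.
  by move=> I /= I1; have [] := CV I (leq_trans I1 (ltn0Sn p)) => cI dI;
    split=> // I0; apply: dI; exact: ltn_trans I0 _.
pose dG (s : R) := gamma * G (x + s *: u) `^ (gamma - 1) *
   nested V 1 [::] u (x + s *: u).
have dGE (s : R) : is_derive s 1 (fun s : R => G (x + s *: u) `^ gamma) (dG s).
  apply: (@is_derive1_comp _ (fun y => y `^ gamma) (fun s : R => G (x + s *: u))).
    by apply: is_derive1_powR; exact: G_gt0.
  have := @is_deriveD _ _ _ (cst (1 : R)) (fun s : R => V (x + s *: u)) s 1 0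
     _ (is_derive_cst _ _ _) (@is_derive_nested _ _ V 1 0 [::] x u s CV1 isT).
  by rewrite add0r.
have [t _] := mean_value 0 1 dGE.
rewrite scale1r scale0r addr0 subr0 mulr1 => /eqP.
rewrite subr_eq => /eqP ->; rewrite [leLHS]addrC lerD2l (le_trans (ler_norm _))//.
set y := x + t *: u.
have nb : `|nested V 1 [::] u y| <= d%:R * a * (c * G y `^ (1 - gamma)).
  rewrite (le_trans (ler_norm_sum _ _ _))// -mulrA mulr_natl.
  rewrite -[X in _ *+ X]card_ord -sumr_const; apply: ler_sum => i _.
  by rewrite normrM ler_pM.
rewrite /dG !normrM (ger0_norm (ltW gamma_gt0)) (ger0_norm (powR_ge0 _ _)).
apply: (@le_trans _ _ (1 * G y `^ (gamma - 1) * (d%:R * a * (c * G y `^ (1 - gamma))))).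
  apply: ler_pM => //.
    by rewrite mulr_ge0 ?powR_ge0// ltW.
  rewrite ler_wpM2r ?powR_ge0//.
  by have /andP[+ _] := gammaM p0; rewrite mul1r subr_ge0.
rewrite mul1r mulrCA [_ * (c * _)]mulrCA -powRD; last by rewrite (gt_eqF (G_gt0 y)) implybT.
by rewrite (_ : gamma - 1 + (1 - gamma) = 0) ?powRr0 ?mulr1//; ring.
Qed.

(** Transfers the growth condition from x + u back to x. The Lipschitz bound gives G(x + u)^gamma <=
    M G(x)^gamma with M affine in K; raising this to the power 1/gamma costs only a power of M. *)
Lemma partials_local_growth : (0 < p)%N ->
  exists C : R, exists N : nat, 0 <= C /\ forall x u (K : R) I, 0 <= K ->
    (forall i, `|u i 0| <= K * G x `^ gamma) -> (size I <= p)%N ->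
    `|partials V I (x + u)| <=
      C * (1 + K) ^+ N * G x `^ (1 - (size I)%:R * gamma).
Proof.
move=> p0; have [c c0 hc] := partials_growth.
(* Rounding 1/gamma up to an integer makes the loss polynomial in K, hence controlled by Gaussian
   moments. *)
pose N := (Num.truncn gamma^-1).+1.
have gN : gamma^-1 <= N%:R by rewrite ltW// truncnS_gt.
have A0 : 0 <= d%:R * c by rewrite mulr_ge0 ?ler0n// ltW.
have A1 : 1 <= 1 + d%:R * c by rewrite lerDl.
exists (c * (1 + d%:R * c) ^+ N), N; split.
  by rewrite mulr_ge0 ?exprn_ge0 ?(ltW c0) ?(le_trans ler01).
move=> x u K I K0 uK sI.
have K1 : 1 <= 1 + K by rewrite lerDl.
rewrite (le_trans (hc _ _ sI))// -!mulrA ler_pM2l//.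
set M := (1 + d%:R * c) * (1 + K).
have M1 : 1 <= M by rewrite mulr_ege1.
have GM : G (x + u) <= M ^+ N * G x.
  have L1 : G (x + u) `^ gamma <= M * G x `^ gamma.
    rewrite (le_trans (@powR_lyapunov_lipschitz c (K * G x `^ gamma) x u _ _ _ _ _))//.
    - exact: ltW.
    - by rewrite mulr_ge0 ?powR_ge0.
    - by move=> i y; have := hc [:: i] y p0; rewrite mul1r.
    rewrite [leLHS](_ : _ = (1 + d%:R * K * c) * G x `^ gamma); last by ring.
    rewrite ler_wpM2r ?powR_ge0// /M mulrDl mul1r mulrDr mulr1.
    by rewrite -[X in X <= _]add0r; nra.
  have := @ge0_ler_powR _ gamma^-1 _ _ _ _ _ L1; rewrite !nnegrE invr_ge0.
  rewrite (ltW gamma_gt0) powR_ge0 mulr_ge0 ?powR_ge0 ?(le_trans ler01)// => /(_ isT isT isT).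
  rewrite powRM ?powR_ge0 ?(le_trans ler01 M1)// -!powRrM divff ?gt_eqF//.
  rewrite !powRr1 ?(ltW (G_gt0 _))// => /le_trans; apply.
  rewrite ler_pM2r// -powR_mulrn ?(le_trans ler01 M1)//.
  by rewrite ler_powR.
have /andP[e0 e1] := gammaM sI.
rewrite [leRHS]mulrA -exprMn -/M.
apply: (@le_trans _ _ ((M ^+ N * G x) `^ (1 - (size I)%:R * gamma))).
  by rewrite ge0_ler_powR// nnegrE ?(ltW (G_gt0 _))// mulr_ge0 ?exprn_ge0 ?(ltW (G_gt0 _)) ?(le_trans ler01 M1).
rewrite powRM ?exprn_ge0 ?(ltW (G_gt0 _)) ?(le_trans ler01 M1)//.
by rewrite ler_wpM2r ?powR_ge0// ler1_powR// exprn_ege1.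
Qed.

Let powRG s x : (s <= p)%N ->
  (G x `^ gamma) ^+ s * G x `^ (1 - s%:R * gamma) = G x.
Proof.
move=> sp; rewrite -powR_mulrn ?powR_ge0// -powRrM -powRD.
  by rewrite mulrC addrCA subrr addr0 powRr1 ?(ltW (G_gt0 _)).
by rewrite (gt_eqF (G_gt0 x)) implybT.
Qed.

(** The s factors G^gamma coming from v restore the full power G(x). The second bound moves the base
    point by u at the price of one more derivative, whence s < p and the additional factor d K. *)
Lemma nested_local_growth : (0 < p)%N ->
  exists C : R, exists N : nat, [/\ 0 <= C,
    forall s x u v (K k : R), 0 <= K -> 0 <= k ->
      (forall i, `|u i 0| <= K * G x `^ gamma) ->
      (forall i, `|v i 0| <= k * G x `^ gamma) -> (s <= p)%N ->
      `|nested V s [::] v (x + u)| <= (d%:R * k) ^+ s * (C * (1 + K) ^+ N) * G x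
  & forall s x u v (K k : R), 0 <= K -> 0 <= k ->
      (forall i, `|u i 0| <= K * G x `^ gamma) ->
      (forall i, `|v i 0| <= k * G x `^ gamma) -> (s < p)%N ->
      `|nested V s [::] v (x + u) - nested V s [::] v x| <=
        (d%:R * k) ^+ s * (d%:R * K) * (C * (1 + K) ^+ N) * G x].
Proof.
move=> p0; have [C [N [C0 hC]]] := partials_local_growth p0.
have D0 (K : R) : 0 <= K -> 0 <= C * (1 + K) ^+ N.
  by move=> K0; rewrite mulr_ge0 ?exprn_ge0 ?addr_ge0.
exists C, N; split=> // s x u v K k K0 k0 uK vk sp.
  have hB J : size J = (s + size (Nil 'I_d))%N ->
      `|partials V J (x + u)| <= C * (1 + K) ^+ N * G x `^ (1 - s%:R * gamma).
    by rewrite addn0 => sJ; rewrite -sJ hC ?sJ.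
  rewrite (le_trans (nested_bound vk _ hB))//.
    by rewrite mulr_ge0 ?powR_ge0 ?D0.
  rewrite -[in leRHS](powRG x sp) [d%:R * (k * _)]mulrA exprMn.
  by rewrite le_eqVlt; apply/orP; left; apply/eqP; ring.
have [CV _ _ _] := hV.
pose B := (d%:R * (K * G x `^ gamma)) *
  (C * (1 + K) ^+ N * G x `^ (1 - s.+1%:R * gamma)).
have B0 : 0 <= B by rewrite !mulr_ge0 ?powR_ge0 ?exprn_ge0 ?addr_ge0.
have dist J : size J = (s + size (Nil 'I_d))%N ->
    `|partials V J (x + u) - partials V J x| <= B.
  rewrite addn0 => sJ.
  have sJ1 : (size J + 0 < p.+1)%N by rewrite addn0 sJ ltnS ltnW.
  have [t] := mean_value 0 1 (fun t => @is_derive_nested _ _ V p.+1 0 J x u t CV sJ1).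
  rewrite !subr0 normr1 scale1r scale0r addr0 mulr1 => t1 ->.
  apply: (le_trans (@nested_bound _ _ V 1 J u _ (K * G x `^ gamma)
    (C * (1 + K) ^+ N * G x `^ (1 - s.+1%:R * gamma)) uK _ _)).
  - by rewrite mulr_ge0 ?powR_ge0 ?D0.
  - move=> J'; rewrite add1n sJ => sJ'; rewrite -sJ'; apply: hC => //.
      move=> i; rewrite mxE normrM (le_trans _ (uK i))// ler_piMl//.
    by rewrite sJ'.
  - by rewrite expr1.
rewrite (le_trans (nested_dist vk B0 dist))// /B.
rewrite -[in leRHS](powRG x sp) [d%:R * (k * _)]mulrA exprMn exprS.
by rewrite le_eqVlt; apply/orP; left; apply/eqP; ring.
Qed.

(* w and v stand for h b and sigma Delta W, a and e for h^(1/2) and h^(1/q). *)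
Lemma one_step_expansion (mu : R) (q : nat) : (2 <= q <= 4)%N -> (q <= p)%N ->
  0 <= mu ->
  exists C : R, exists N : nat, 0 <= C /\ forall x w v (h a e kappa : R),
    0 <= a <= 1 -> 0 <= e <= 1 -> 0 <= kappa ->
    a ^+ 2 <= h -> e ^+ q <= h -> ((2 < q)%N -> a * e ^+ 2 <= h) ->
    (forall i, `|w i 0| <= mu * a * G x `^ gamma) ->
    (forall i, `|v i 0| <= mu * e * kappa * G x `^ gamma) ->
    V (x + w + v) + V (x + w - v) <=
      2 * V x + 2 * nested V 1 [::] w x + nested V 2 [::] v x
      + C * h * G x * (1 + kappa) ^+ N.
Proof.
move=> /andP[q2 q4] qp mu0; have p2 : (2 <= p)%N := leq_trans q2 qp.
have [CV _ _ _] := hV.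
have CVn n : (n <= p)%N -> class_C n V.
  move=> np I sI; have [] := CV I (leq_trans sI (leqW np)) => cI dI; split=> // sI'.
  by apply: dI; rewrite (leq_trans sI')// (leq_trans np).
have [C [N [C0 hC hD]]] := nested_local_growth (ltnW p2).
pose dm := d%:R * mu; have dm0 : 0 <= dm by rewrite mulr_ge0.
pose D := C * (1 + mu) ^+ N.
have D0 : 0 <= D by rewrite mulr_ge0 ?exprn_ge0 ?addr_ge0.
(* The three powers of [dm] pay for the remainder in w, the displacement of the order 2 term, and
   the remainder in v. The last is doubled for q = 2, where the order 2 term is added as well. In
   the exponent, N comes from the local growth and 4 from the at most four factors v. *)
exists (D * (dm ^+ 2 + dm ^+ 3 + dm ^+ q *+ 2)), (N + 4)%N; split.
  by rewrite mulr_ge0// !addr_ge0// ?mulrn_wge0// exprn_ge0.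
move=> x w v h a e kappa /andP[a0 a1] /andP[e0 e1] k0 ah eh aeh wa ve.
have h0 : 0 <= h by rewrite (le_trans _ ah)// exprn_ge0.
have L0 : 0 <= G x `^ gamma by exact: powR_ge0.
have k1 : 1 <= 1 + kappa by rewrite lerDl.
pose X := (1 + kappa) ^+ (N + 4).
have X0 : 0 <= X by rewrite exprn_ge0// (le_trans ler01).
pose H := D * h * G x * X.
have H0 : 0 <= H.
  by apply: mulr_ge0 X0; apply: mulr_ge0 (ltW (G_gt0 x)); exact: mulr_ge0.
(* Gathers in X both sources of powers of kappa: the j factors v, and the growth of V at a distance
   governed by K. *)
have MX (K : R) j : (j <= 4)%N -> 0 <= K <= mu * (1 + kappa) ->
    kappa ^+ j * (C * (1 + K) ^+ N) <= D * X.
  move=> j4 /andP[K0 K1].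
  have KM : (1 + K) ^+ N <= (1 + mu) ^+ N * (1 + kappa) ^+ N.
    rewrite -exprMn lerXn2r ?nnegrE ?mulr_ge0 ?addr_ge0// mulrDl mul1r; lra.
  have kj : kappa ^+ j <= (1 + kappa) ^+ 4.
    apply: (@le_trans _ _ ((1 + kappa) ^+ j)); last exact: ler_weXn2l.
    by rewrite lerXn2r ?nnegrE ?addr_ge0// lerDr.
  rewrite /D /X exprD [leRHS](_ : _ =
    (1 + kappa) ^+ 4 * (C * ((1 + mu) ^+ N * (1 + kappa) ^+ N))); last by ring.
  rewrite ler_pM ?exprn_ge0// ?mulr_ge0 ?exprn_ge0 ?addr_ge0//.
  by rewrite ler_wpM2l.
have aK : 0 <= mu * a <= mu * (1 + kappa).
  by rewrite mulr_ge0//= ler_wpM2l// (le_trans a1).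
have akK : 0 <= mu * (1 + kappa) <= mu * (1 + kappa).
  by rewrite lexx mulr_ge0// (le_trans ler01).
have zK : 0 <= (0 : R) <= mu * (1 + kappa) by rewrite lexx; case/andP: akK.
have ek0 : 0 <= mu * e * kappa by rewrite !mulr_ge0.
have scal (t : R) : (`|t| <= 1) -> forall i, `|(t *: w) i 0| <= mu * a * G x `^ gamma.
  by move=> t1 i; rewrite mxE normrM (le_trans _ (wa i))// ler_piMl.
have segment (s : R) : -1 <= s <= 1 ->
    forall i, `|(w + s *: v) i 0| <= mu * (1 + kappa) * G x `^ gamma.
  move=> s1 i; rewrite !mxE (le_trans (ler_normD _ _))//.
  rewrite [leRHS](_ : _ = mu * 1 * G x `^ gamma + 1 * (mu * 1 * kappa * G x `^ gamma)); last by ring.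
  apply: lerD; first by rewrite (le_trans (wa i))// ler_wpM2r// ler_wpM2l.
  rewrite normrM ler_pM//; first by rewrite ler_norml.
  by rewrite (le_trans (ve i))// ler_wpM2r// ler_wpM2r// ler_wpM2l.
have F1 : V (x + w) <= V x + nested V 1 [::] w x + dm ^+ 2 * H / 2.
  have := @taylor_directional _ _ V 2 x w (dm ^+ 2 * H) (CVn 2%N p2).
  have -> : \sum_(j < 2) nested V j [::] w x / j`!%:R = V x + nested V 1 [::] w x.
    by rewrite !big_ord_recl big_ord0 !factE divr1 invr1 mulr1 addr0.
  apply.
  move=> s /andP[s0 s1]; rewrite (le_trans (ler_norm _))//.
  have [K1 _] := andP aK.
  rewrite (le_trans (hC 2%N x (s *: w) w _ _ K1 K1 (scal s _) wa p2))//.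
    by rewrite ger0_norm.
  rewrite [leLHS](_ : _ = dm ^+ 2 * a ^+ 2 * (C * (1 + mu * a) ^+ N) * G x); last first.
    by rewrite /dm; ring.
  rewrite /H [leRHS](_ : _ = dm ^+ 2 * h * (D * X) * G x); last by ring.
  rewrite ler_wpM2r ?(ltW (G_gt0 _))// ler_pM ?mulr_ge0 ?exprn_ge0 ?addr_ge0//.
    by rewrite ler_wpM2l ?exprn_ge0.
  by have := MX _ 0%N isT aK; rewrite expr0 mul1r.
(* The displacement u is left free: it is w + s v in the Taylor remainder, and 0 when q = 2. *)
have ekq (u : 'cV[R]_d) (K : R) : 0 <= K <= mu * (1 + kappa) ->
    (forall i, `|u i 0| <= K * G x `^ gamma) ->
    `|nested V q [::] v (x + u)| <= dm ^+ q * H.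
  move=> Kk uK; have [K0 _] := andP Kk.
  rewrite (le_trans (hC q x u v _ _ K0 ek0 uK ve qp))//.
  rewrite [leLHS](_ : _ =
    dm ^+ q * e ^+ q * (kappa ^+ q * (C * (1 + K) ^+ N)) * G x); last first.
    by rewrite /dm -exprMn [in RHS]mulrA -exprMn !mulrA.
  rewrite /H [leRHS](_ : _ = dm ^+ q * h * (D * X) * G x); last by ring.
  rewrite ler_wpM2r ?(ltW (G_gt0 _))// ler_pM ?mulr_ge0 ?exprn_ge0 ?addr_ge0//.
    by rewrite ler_wpM2l ?exprn_ge0.
  exact: MX.
have F3 := @taylor_symmetric _ _ V q (x + w) v (dm ^+ q * H) (CVn q qp) _.
have {}F3 := F3 (fun s s1 => eq_ind_r (fun z => `|nested V q [::] v z| <= _)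
  (ekq _ _ akK (segment s s1)) (esym (addrA x w (s *: v)))).
have dmqH : 0 <= dm ^+ q * H by rewrite mulr_ge0 ?exprn_ge0.
have dm3H : 0 <= dm ^+ 3 * H by rewrite mulr_ge0 ?exprn_ge0.
(* Moving the base point of the order 2 term from x + w to x uses third derivatives, available as
   soon as q >= 3. *)
have F2 : (2 < q)%N -> nested V 2 [::] v (x + w) <= nested V 2 [::] v x + dm ^+ 3 * H.
  move=> q3; rewrite -lerBlDl (le_trans (ler_norm _))//.
  have [K1 _] := andP aK.
  rewrite (le_trans (hD 2%N x w v _ _ K1 ek0 wa ve (leq_trans q3 qp)))//.
  rewrite [leLHS](_ : _ = dm ^+ 3 * (a * e ^+ 2) *
    (kappa ^+ 2 * (C * (1 + mu * a) ^+ N)) * G x); last by rewrite /dm; ring.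
  rewrite /H [leRHS](_ : _ = dm ^+ 3 * h * (D * X) * G x); last by ring.
  rewrite ler_wpM2r ?(ltW (G_gt0 _))// ler_pM ?mulr_ge0 ?exprn_ge0 ?addr_ge0//.
    by rewrite ler_wpM2l ?exprn_ge0// aeh.
  exact: MX.
rewrite (_ : _ * h * _ * _ = (dm ^+ 2 + dm ^+ 3 + dm ^+ q *+ 2) * H); last first.
  by rewrite /H /X; ring.
(* For q = 2 the expansion stops before the order 2 term that the conclusion contains; this term is
   inserted at a cost of order e^2 <= h. *)
have F4 : q = 2%N -> - nested V 2 [::] v x <= dm ^+ q * H.
  move=> q2'; rewrite (le_trans (ler_norm _))// normrN -[in nested V 2]q2'.
  rewrite -{1}[x]addr0; apply: (ekq 0 0) => // i.
  by rewrite mxE normr0 mul0r.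
have even2 (f : nat -> R) : \sum_(j < 2 | ~~ odd j) f j = f 0%N.
  by rewrite big_mkcond !big_ord_recl big_ord0 /= !addr0.
have even3 (f : nat -> R) : \sum_(j < 3 | ~~ odd j) f j = f 0%N + f 2%N.
  by rewrite big_mkcond !big_ord_recl big_ord0 /= !addr0 add0r.
have even4 (f : nat -> R) : \sum_(j < 4 | ~~ odd j) f j = f 0%N + f 2%N.
  by rewrite big_mkcond !big_ord_recl big_ord0 /= !addr0 add0r.
move: F1 F2 F3 F4 dmqH dm3H.
set T2x := nested V 2 _ _ x; set T2w := nested V 2 _ _ (x + w).
set T1 := nested V 1 _ _ _.
have [qE|q_neq2] := eqVneq q 2%N; last have [qE|q_neq3] := eqVneq q 3%N.
- rewrite qE (even2 (fun j => 2 * nested V j [::] v (x + w) / j`!%:R)).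
  by move=> F1 _ + /(_ erefl); rewrite !factE -/T2x [nested V 0 _ _ _]/=; lra.
- rewrite qE (even3 (fun j => 2 * nested V j [::] v (x + w) / j`!%:R)).
  move=> F1 /(_ isT) + + _; rewrite !factE -/T2w [nested V 0 _ _ _]/=; lra.
- have -> : q = 4%N by case: (q) q2 q4 q_neq2 q_neq3 => [|[|[|[|[|[]]]]]].
  rewrite (even4 (fun j => 2 * nested V j [::] v (x + w) / j`!%:R)).
  move=> F1 /(_ isT) + + _; rewrite !factE -/T2w [nested V 0 _ _ _]/=; lra.
Qed.

End lyapunov_growth.

(** * Borel sets of matrices *)

Section borel_matrices.
Context (R : realType).

Lemma continuous_borel_measurable (T : ptopologicalType) (g : T -> R) :
  continuous g -> measurable_fun setT (g : borel T -> R).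
Proof.
move=> cg; apply: (measurability _ (RGenOpens.measurableE R)).
move=> _ [_ [a [b ->]] <-]; rewrite setTI; apply: sub_sigma_algebra.
by apply: open_comp => [x _|]; [exact: cg|exact: interval_open].
Qed.

Lemma measurable_entry (m n : nat) (i : 'I_m) (j : 'I_n) :
  measurable_fun setT (fun A : borel 'M[R]_(m, n) => A i j).
Proof. by apply: continuous_borel_measurable; exact: coord_continuous. Qed.

(* An open set is the union of the balls with rational centre and radius that
   it contains; there are countably many of them. *)
Lemma measurable_mx d (T : measurableType d) (m n : nat) (f : T -> 'M[R]_(m, n)) :
  (forall i j, measurable_fun setT (fun t => f t i j)) ->
  measurable_fun setT (f : T -> borel 'M[R]_(m, n)).
Proof.
move=> mf.
apply: (measurability _ (erefl : @measurable _ (borel 'M[R]_(m, n)) = <<s open >>)).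
move=> _ [U oU <-]; rewrite setTI.
pose B (q : 'M[rat]_(m, n) * nat) : set 'M[R]_(m, n) :=
  [set A | forall i j, `|A i j - ratr (q.1 i j)| < q.2.+1%:R^-1].
pose B' q := if asbool (B q `<=` U) then f @^-1` B q else set0.
have -> : f @^-1` U = \bigcup_q B' q.
  apply/seteqP; split => t /=; last first.
    by move=> [q _]; rewrite /B'; case: asboolP => // BU; exact: BU.
  move=> Uft; have /nbhs_ballP[e /= e0 eU] : nbhs (f t) U by exact: open_nbhs_nbhs.
  (* The rational centre is within 1/(k+1) of [f t], and so is every point of the box from the
     centre; two such distances must stay below e. *)
  pose k := Num.truncn (2 / e).
  have ke : k.+1%:R^-1 < e / 2.
    rewrite -[e / 2]invrK ltf_pV2 ?posrE ?invr_gt0 ?divr_gt0// invf_div.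
    exact: truncnS_gt.
  have ratq i j : {q : rat | `|f t i j - ratr q| < k.+1%:R^-1}.
    have k0 : f t i j - k.+1%:R^-1 < f t i j + k.+1%:R^-1.
      by rewrite ltrD2l gtrN// invr_gt0.
    have [q /[!in_itv]/= /andP[q1 q2]] := cid (rat_in_itvoo k0).
    by exists q; rewrite distrC ltr_distl q1 q2.
  exists (\matrix_(i, j) sval (ratq i j), k) => //; rewrite /B'.
  case: asboolP => [_ i j /=|[]]; first by rewrite mxE; case: (ratq i j).
  move=> A BA; apply: eU; split=> // i j.
  have := BA i j; rewrite /= mxE; case: (ratq i j) => q /= q1 q2.
  rewrite /ball/= (le_lt_trans (ler_distD (ratr q) _ _))//.
  by rewrite [ltRHS](splitr e) ltrD// ?(lt_trans _ ke)// distrC.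
apply: countable_bigcupT_measurable => // q; rewrite /B'; case: asboolP => // _.
have -> : f @^-1` B q = \bigcap_(ij : 'I_m * 'I_n)
    ((fun t => f t ij.1 ij.2) @^-1` [set x | `|x - ratr (q.1 ij.1 ij.2)| < q.2.+1%:R^-1]).
  by apply/seteqP; split => [t /= Bt [i j] _|t /= Bt i j]; [exact: Bt|exact: (Bt (i, j))].
apply: fin_bigcap_measurable => // -[i j] _.
rewrite -[X in measurable X]setTI; apply: mf => //.
have -> : [set x : R | `|x - ratr (q.1 i j)| < q.2.+1%:R^-1] =
    [set` `]ratr (q.1 i j) - q.2.+1%:R^-1, ratr (q.1 i j) + q.2.+1%:R^-1[].
  by apply/seteqP; split => x /=; rewrite in_itv/= ltr_distl.
exact: measurable_itv.
Qed.

Definition box (m : nat) (A : 'I_m -> set R) : set 'cV[R]_m :=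
  [set z | forall i, A i (z i 0)].

Definition boxes (m : nat) : set (set 'cV[R]_m) :=
  [set B | exists2 A : 'I_m -> set R, (forall i, measurable (A i)) & B = box A].

Lemma measurable_box (m : nat) (A : 'I_m -> set R) :
  (forall i, measurable (A i)) -> measurable (box A : set (borel 'cV[R]_m)).
Proof.
move=> mA.
have -> : box A = \bigcap_(i : 'I_m) ((fun z : 'cV[R]_m => z i 0) @^-1` A i).
  by apply/seteqP; split => z /= Bz i; [move=> _; exact: Bz|exact: Bz].
apply: fin_bigcap_measurable => // i _.
by rewrite -[X in measurable X]setTI; exact: measurable_entry.
Qed.

(** The coordinates are measurable for the sigma-algebra generated by boxes, so [measurable_mx]
    applied to the identity yields the inclusion that is not immediate. *)
Lemma borel_boxes (m : nat) :
  @measurable _ (borel 'cV[R]_m) = <<s @boxes m >>.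
Proof.
apply/seteqP; split; last first.
  by apply: smallest_sub => [|_ [A mA ->]];
    [exact: sigma_algebra_measurable|exact: measurable_box].
have idm : measurable_fun setT (id : g_sigma_algebraType (@boxes m) -> borel 'cV[R]_m).
  apply: measurable_mx => i j _ Y mY; rewrite setTI; apply: sub_sigma_algebra.
  exists (fun k => if k == i then Y else setT) => [k|]; first by case: ifP.
  apply/seteqP; split => z /=; rewrite (ord1 j).
    by move=> Yz k; case: eqP => [->|].
  by move=> /(_ i); rewrite eqxx.
by move=> B mB; have := idm measurableT B mB; rewrite setTI.
Qed.

(** Boxes are stable under intersection and generate the Borel sets. The law of the increments,
    prescribed on boxes only, is thereby determined. *)
Lemma eq_measure_boxes (m : nat)
    (m1 m2 : {measure set (borel 'cV[R]_m) -> \bar R}) :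
  (m1 setT < +oo)%E -> (forall A, (forall i, measurable (A i)) -> m1 (box A) = m2 (box A)) ->
  forall B, measurable B -> m1 B = m2 B.
Proof.
move=> m1oo m12 B.
apply: (@measure_unique _ _ (borel 'cV[R]_m) (@boxes m) (fun=> setT) _ _ _ _ m1 m2) => //.
- exact: borel_boxes.
- move=> _ _ [A mA ->] [A' mA' ->]; exists (fun i => A i `&` A' i).
    by move=> i; exact: measurableI.
  by apply/seteqP; split => z /= => [[h1 h2] i|h]; [split|split => i; have [] := h i].
- by move=> _; exists (fun=> setT) => //; apply/seteqP; split.
- by apply/seteqP; split => // z _; exists 0%N.
- by move=> _ [A mA ->]; exact: m12.
Qed.

End borel_matrices.

(** * Gaussian moments *)

Section real_inequalities.
Context {R : realType}.
Implicit Types (x u y t th : R).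

Lemma expR_abs_le x : expR `|x| <= expR x + expR (- x).
Proof.
have [x0|/ltW x0] := leP 0 x; first by rewrite ger0_norm// lerDl expR_ge0.
by rewrite ler0_norm// lerDr expR_ge0.
Qed.

Lemma expr_le_expR n x : 0 <= x -> x ^+ n <= n`!%:R * expR x.
Proof.
case: n => [|n] x0; first by rewrite expr0 mul1r -expR0 ler_expR.
rewrite mulrC -ler_pdivrMr ?ltr0n ?fact_gt0//.
by rewrite (le_trans _ (expR_ge1Dxn n x0))// lerDr.
Qed.

(** The j-th derivative in t of 2 cosh(t u). *)
Let cosh_family (u : R) (j : nat) (t : R) : R :=
  u ^+ j * (expR (t * u) + (-1) ^+ j * expR (- (t * u))).

Let is_derive_cosh_family (u : R) (j : nat) (t : R) :
  is_derive t 1 (cosh_family u j) (cosh_family u j.+1 t).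
Proof.
have dexp (c : R) : is_derive t 1 (fun t => expR (t * c)) (expR (t * c) * c).
  apply: (@is_derive1_comp _ expR (fun t => t * c)).
  rewrite (_ : (fun t => t * c) = c *: id).
    by rewrite -[X in is_derive _ _ _ X]mulr1; exact: is_deriveZ.
  by apply/funext => z; rewrite scalrfctE mulrC.
rewrite (_ : cosh_family u j = u ^+ j *: ((fun t => expR (t * u)) +
    (-1) ^+ j *: (fun t => expR (t * (- u))))); last first.
  by apply/funext => z; rewrite /cosh_family -mulrN.
rewrite (_ : cosh_family u j.+1 t = u ^+ j *: (expR (t * u) * u +
    (-1) ^+ j *: (expR (t * - u) * (- u)))); last first.
  by rewrite /cosh_family -mulrN !exprS -![_ *: _]/(_ * _); ring.
exact: (is_deriveZ _ (is_deriveD (dexp u) (is_deriveZ _ (dexp (- u))))).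
Qed.

Lemma cosh_lower_bound u : 2 + u ^+ 2 <= expR u + expR (- u).
Proof.
(* [taylor_upper_bound] is one-sided, so a lower bound is obtained by changing the sign. *)
pose f j t := - cosh_family u j t.
have df (j : nat) (s : R) : (j < 2)%N -> is_derive s 1 (f j) (f j.+1 s).
  by move=> _; apply: is_deriveN; exact: is_derive_cosh_family.
have fB (s : R) : 0 <= s <= 1 -> f 2%N s <= - (2 * u ^+ 2).
  move=> _; rewrite /f /cosh_family lerN2 mulrC ler_wpM2l ?sqr_ge0// sqrrN expr1n mul1r.
  by have := expR_ge1Dx (s * u); have := expR_ge1Dx (- (s * u)); lra.
have /(_ 1) := taylor_upper_bound df fB; rewrite ler01 lexx => /(_ isT).
have -> : \sum_(j < 2) f j 0 * (1 ^+ j / j`!%:R) = - 2.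
  rewrite !big_ord_recr big_ord0 /= /f /cosh_family mul0r oppr0 expR0 !factE.
  by rewrite expr0 expr1; field.
rewrite /f /cosh_family !factE expr1n !mul1r ?expr0 ?mul1r; lra.
Qed.

Lemma cosh_upper_bound u : expR u + expR (- u) <= 2 + u ^+ 2 + u ^+ 4 * expR `|u|.
Proof.
have fB (s : R) : 0 <= s <= 1 -> cosh_family u 4 s <= u ^+ 4 * (2 * expR `|u|).
  move=> /andP[s0 s1].
  rewrite /cosh_family ler_wpM2l ?exprn_even_ge0// (_ : (-1) ^+ 4 = 1) ?mul1r; last by ring.
  have su : `|s * u| <= `|u| by rewrite normrM ler_piMl// ger0_norm.
  rewrite mulr_natl mulr2n lerD// ler_expR (le_trans (ler_norm _))//.
  by rewrite normrN.
have /(_ 1) := taylor_upper_bound (fun j s _ => is_derive_cosh_family u j s) fB.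
rewrite ler01 lexx => /(_ isT).
have -> : \sum_(j < 4) cosh_family u j 0 * (1 ^+ j / j`!%:R) = 2 + u ^+ 2.
  rewrite !big_ord_recr big_ord0 /= /cosh_family mul0r oppr0 expR0 !factE.
  by rewrite expr0 expr1; field.
have : 0 <= u ^+ 4 * expR `|u| by rewrite mulr_ge0 ?expR_ge0// exprn_even_ge0.
rewrite /cosh_family !factE expr1n !mul1r ?expr0 ?mul1r.
set e := _ * expR `|_|; rewrite (_ : u ^+ 4 * (2 * _) = 2 * e); last by rewrite /e; ring.
lra.
Qed.

(** From 1 - t <= exp(-t) one gets exp t <= 1/(1 - t), and t <= 1/2 bounds this quotient by the
    polynomial. *)
Lemma expR_quadratic_bound t : 0 <= t <= 2^-1 -> expR t <= 1 + t + 2 * t ^+ 2.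
Proof.
move=> /andP[t0 t1].
have h : 1 - t <= (expR t)^-1 by rewrite -expRN (le_trans _ (expR_ge1Dx _)).
have t2 : 0 < 1 - t by lra.
rewrite -[leLHS]invrK (le_trans (_ : _ <= (1 - t)^-1))//.
  by rewrite lef_pV2// posrE invr_gt0 expR_gt0.
rewrite -[(1 - t)^-1]mul1r ler_pdivrMr//; nra.
Qed.

Lemma eq_of_quadratic_closeness x y (K : R) :
  (forall th, 0 < th <= 1 -> `|x - y| <= K * th ^+ 2) -> x = y.
Proof.
move=> h; apply/eqP; rewrite -subr_eq0 -normr_eq0 eq_le normr_ge0 andbT.
rewrite leNgt; apply/negP => d0.
have K0 : 0 < K by have := h 1; rewrite ltr01 lexx expr1n mulr1 => /(_ isT); exact: lt_le_trans.
set D := `|x - y| in h d0.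
pose th := Num.min 1 (D / (2 * K)).
have q0 : 0 < D / (2 * K) by rewrite divr_gt0// mulr_gt0.
have th0 : 0 < th by rewrite lt_min ltr01.
have th1 : th <= 1 by rewrite ge_min lexx.
have := h th; rewrite th0 th1 => /(_ isT).
have : K * th ^+ 2 <= D / 2.
  rewrite (_ : D / 2 = K * (D / (2 * K))); last by field; rewrite gt_eqF.
  rewrite ler_pM2l// expr2 (le_trans (_ : _ <= 1 * th))//.
    by rewrite ler_pM2r.
  by rewrite mul1r ge_min lexx orbT.
lra.
Qed.

(** Comparing the two brackets of E and dividing by t leaves an error t on one side and K t on the
    other. In the application E = 2 exp(t/2), and M is the second moment of the standard normal
    law. *)
Lemma squeeze_around_one (M K t E : R) : 0 < t -> 0 <= K ->
  2 + t * M <= E -> E <= 2 + t * M + t ^+ 2 * K ->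
  2 + t <= E -> E <= 2 + t + t ^+ 2 -> `|M - 1| <= (K + 1) * t.
Proof.
move=> t0 K0 h1 h2 h3 h4.
have t2 : 0 <= t ^+ 2 by exact: sqr_ge0.
have Kt2 : 0 <= t ^+ 2 * K by exact: mulr_ge0.
by rewrite ler_distl; apply/andP; split; rewrite -(ler_pM2l t0); lra.
Qed.

End real_inequalities.

(** * Moments of a centred normal law on the line *)

Section centered_normal.
Context {R : realType}.
Variable s : R.
Hypothesis s0 : 0 < s.
Local Notation N := (normal_prob (0 : R) s).
Local Notation mu := (@lebesgue_measure R).
Local Open Scope ereal_scope.

Let s_neq0 : s != 0%R. Proof. by rewrite gt_eqF. Qed.

(** The Radon-Nikodym derivative and the explicit density have the same integral over every
    measurable set, hence agree almost everywhere. *)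
Lemma ge0_integral_normal_prob (f : R -> \bar R) :
  measurable_fun setT f -> (forall x, 0 <= f x) ->
  \int[N]_x f x = \int[mu]_x (f x * (normal_pdf 0 s x)%:E).
Proof.
move=> mf f0.
have domN := normal_prob_dominates (0 : R)%R s.
rewrite -(Radon_Nikodym_SigmaFinite.change_of_variables domN f0 measurableT mf).
have iRN := Radon_Nikodym_SigmaFinite.f_integrable domN.
apply: ae_eq_integral => //.
- by apply: emeasurable_funM => //; exact: measurable_int iRN.
- apply: emeasurable_funM => //; apply/measurable_EFinP.
  exact: measurable_normal_pdf.
apply: ae_eqe_mul2l; apply: integral_ae_eq => //.
- by apply/measurable_EFinP; exact: measurable_normal_pdf.
- by move=> E _ mE; rewrite -Radon_Nikodym_SigmaFinite.f_integral.
Qed.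

Lemma normal_probN (A : set R) : measurable A -> N (-%R @^-1` A) = N A.
Proof.
move=> mA; rewrite /normal_prob.
transitivity (\int[pushforward mu (-%R : _ -> measurableTypeR R)]_(x in A) (normal_pdf 0 s x)%:E).
  rewrite ge0_integral_pushforward//=.
  - apply: eq_integral => x _; rewrite !normal_pdfE// /normal_fun.
    by rewrite !subr0 sqrrN.
  - by apply/measurable_EFinP/measurable_funTS; exact: measurable_normal_pdf.
  - by move=> x _; rewrite lee_fin normal_pdf_ge0.
by apply: eq_measure_integral => B mB _; exact: lebesgue_measureN.
Qed.

(** Completing the square turns exp(c x / s) times the density into exp(c^2 / 2) times the normal
    density of mean c s. *)
Lemma normal_exponential_moment (c : R) :
  \int[N]_x (expR (c * x / s))%:E = (expR (c ^+ 2 / 2))%:E.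
Proof.
rewrite ge0_integral_normal_prob; last 2 first.
- apply/measurable_EFinP; apply: continuous_measurable_fun => x.
  apply: (@continuous_comp _ _ _ (fun x => c * x / s)%R expR); last exact: continuous_expR.
  by apply: cvgM; [apply: cvgM; [exact: cvg_cst|exact: cvg_id]|exact: cvg_cst].
- by move=> x; rewrite lee_fin expR_ge0.
transitivity (\int[mu]_x ((expR (c ^+ 2 / 2))%:E * (normal_pdf (c * s) s x)%:E)).
  apply: eq_integral => x _; rewrite -!EFinM; congr (_%:E).
  rewrite !normal_pdfE// mulrCA [RHS]mulrCA; congr (_ * _)%R.
  rewrite /normal_fun -!expRD; congr expR.
  by field.
rewrite ge0_integralZl ?lee_fin ?expR_ge0//.
- by rewrite integral_normal_pdf mule1.
- by apply/measurable_EFinP; exact: measurable_normal_pdf.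
- by move=> x _; rewrite lee_fin normal_pdf_ge0.
Qed.

Let measurable_scaled (g : R -> R) : continuous g ->
  measurable_fun setT (fun x : R => (g (x / s))%:E).
Proof.
move=> cg; apply/measurable_EFinP.
apply: (measurableT_comp (continuous_measurable_fun cg)).
exact: measurable_funM.
Qed.

Let cosh_moment (c : R) :
  \int[N]_x (expR (c * (x / s)) + expR (- (c * (x / s))))%:E =
  (2 * expR (c ^+ 2 / 2))%:E.
Proof.
under eq_integral do rewrite EFinD -mulNr.
have mexp (k : R) : measurable_fun setT (fun x : R => (expR (k * (x / s)))%:E).
  apply: (@measurable_scaled (fun y => expR (k * y))) => y.
  apply: (@continuous_comp _ _ _ (fun x => k * x)%R expR); last exact: continuous_expR.
  by apply: cvgM; [exact: cvg_cst|exact: cvg_id].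
rewrite ge0_integralD//; [|exact: mexp|exact: mexp].
under eq_integral do rewrite mulrA.
under [X in _ + X]eq_integral do rewrite mulrA.
by rewrite !normal_exponential_moment sqrrN -EFinD mulr_natl mulr2n.
Qed.

(** By |y|^n <= n! exp |y| and the exponential moments. After division by s the bound does not
    depend on s, that is, on the step size. *)
Lemma normal_moment_bound (n : nat) :
  \int[N]_x ((`|x| / s) ^+ n)%:E <= (n`!%:R * (2 * expR (1 / 2)))%:E.
Proof.
have mcosh : measurable_fun setT (fun x : R => (expR (x / s) + expR (- (x / s)))%:E).
  apply: (@measurable_scaled (fun y => expR y + expR (- y))%R) => y.
  apply: cvgD; first exact: continuous_expR.
  apply: (@continuous_comp _ _ _ (fun x : R => - x)%R expR); last exact: continuous_expR.
  by apply: cvgN; exact: cvg_id.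
apply: (@le_trans _ _ (\int[N]_x (n`!%:R%:E * (expR (x / s) + expR (- (x / s)))%:E))).
  apply: ge0_le_integral => //.
  - by move=> x _; rewrite lee_fin exprn_ge0// divr_ge0// ltW.
  - apply/measurable_EFinP; apply: measurable_funX; exact: measurable_funM.
  - exact: measurable_funeM.
  - move=> x _; rewrite -EFinM lee_fin.
    have -> : (`|x| / s = `|x / s|)%R by rewrite normrM normfV (gtr0_norm s0).
    by rewrite (le_trans (expr_le_expR _ _))// ler_wpM2l// expR_abs_le.
rewrite ge0_integralZl//.
under eq_integral do rewrite -[(_ / s)%R]mul1r.
by rewrite cosh_moment expr1n -EFinM.
Qed.

(* The exponential moments are explicit, and 2 cosh(th y) - 2 - th^2 y^2 is of
   order th^4 in mean; divide by th^2 and let th tend to 0. *)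
Lemma normal_second_moment : \int[N]_x (x ^+ 2)%:E = (s ^+ 2)%:E.
Proof.
pose y (x : R) := (x / s)%R.
have my2 : measurable_fun setT (fun x : R => (y x ^+ 2)%:E).
  apply: (@measurable_scaled (fun y => y ^+ 2)%R); exact: exprn_continuous.
have mexp (k : R) : measurable_fun setT (fun x : R => (expR (k * y x) + expR (- (k * y x)))%:E).
  apply: (@measurable_scaled (fun y => expR (k * y) + expR (- (k * y)))%R) => z.
  have ck (a : R) : {for z, continuous (fun z => expR (a * z))}.
    apply: (@continuous_comp _ _ _ (fun x => a * x)%R expR); last exact: continuous_expR.
    by apply: cvgM; [exact: cvg_cst|exact: cvg_id].
  by apply: cvgD; [exact: ck|under eq_fun do rewrite -mulNr; rewrite -mulNr; exact: ck].
have M0 : 0 <= \int[N]_x (y x ^+ 2)%:E.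
  by apply: integral_ge0 => x _; rewrite lee_fin sqr_ge0.
have : \int[N]_x (y x ^+ 2)%:E < +oo.
  apply: le_lt_trans (ltry (2`!%:R * (2 * expR (1 / 2)))%R).
  apply: le_trans (normal_moment_bound 2).
  rewrite le_eqVlt; apply/orP; left; apply/eqP; apply: eq_integral => x _.
  by rewrite /y !expr_div_n -normrX ger0_norm// sqr_ge0.
rewrite ltey_eq => /orP[/fineK M_fin|/eqP M_ny]; last by rewrite M_ny in M0.
set M := fine _ in M_fin.
suff M1 : M = 1%R.
  transitivity (\int[N]_x ((s ^+ 2)%:E * (y x ^+ 2)%:E)).
    apply: eq_integral => x _; rewrite -EFinM /y; congr (_%:E).
    by field.
  rewrite ge0_integralZl ?lee_fin ?sqr_ge0//; first by rewrite -M_fin M1 mule1.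
  by move=> x _; rewrite lee_fin sqr_ge0.
have ge2 (k : R) (k0 : (0 <= k)%R) : \int[N]_x (2 + k * y x ^+ 2)%:E = (2 + k * M)%:E.
  under eq_integral do rewrite EFinD EFinM.
  rewrite ge0_integralD//=.
  - rewrite ge0_integralZl//.
      rewrite -M_fin integral_cst// (_ : _ setT = 1) ?mule1 ?EFinD ?EFinM//.
      exact: (@probability_setT _ _ _ (normal_prob (0 : R) s)).
    by move=> x _; rewrite lee_fin sqr_ge0.
  - by move=> x _; rewrite -EFinM lee_fin mulr_ge0 ?sqr_ge0.
  - exact: measurable_funeM.
(* From y^4 <= 4! exp |y| and exp |th y| <= exp |y|, the remainder of 2 cosh(th y) is at most th^4
   times 24 (exp(2 y) + exp(-2 y)); K is the mean of the latter. *)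
pose K : R := (24 * (2 * expR (2 ^+ 2 / 2)))%R.
apply: (@eq_of_quadratic_closeness _ _ _ (K + 1)) => th /andP[th0 th1].
have lb : (2 + th ^+ 2 * M <= 2 * expR (th ^+ 2 / 2))%R.
  rewrite -lee_fin -ge2 ?sqr_ge0// -(cosh_moment th).
  apply: ge0_le_integral => //.
  - by move=> x _; rewrite lee_fin addr_ge0// mulr_ge0// sqr_ge0.
  - under eq_fun do rewrite EFinD EFinM.
    by apply: emeasurable_funD => //; exact: measurable_funeM.
  - exact: mexp.
  - by move=> x _; rewrite lee_fin -exprMn cosh_lower_bound.
have ub : (2 * expR (th ^+ 2 / 2) <= 2 + th ^+ 2 * M + th ^+ 4 * K)%R.
  rewrite -lee_fin -(cosh_moment th) EFinD -ge2 ?sqr_ge0//.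
  have -> : (th ^+ 4 * K)%:E = \int[N]_x ((24 * th ^+ 4)%:E *
      (expR (2 * y x) + expR (- (2 * y x)))%:E).
    rewrite ge0_integralZl//.
    + by rewrite cosh_moment -EFinM; congr (_%:E); rewrite /K; ring.
    + exact: mexp.
    + by rewrite lee_fin mulr_ge0// exprn_ge0// ltW.
  have m2y : measurable_fun setT (fun x : R => (2 + th ^+ 2 * y x ^+ 2)%:E).
    under eq_fun do rewrite EFinD EFinM.
    by apply: emeasurable_funD => //; exact: measurable_funeM.
  have me2 : measurable_fun setT (fun x : R => (24 * th ^+ 4)%:E *
      (expR (2 * y x) + expR (- (2 * y x)))%:E).
    by apply: measurable_funeM; exact: mexp.
  have y0 x : 0 <= (2 + th ^+ 2 * y x ^+ 2)%:E.
    by rewrite lee_fin addr_ge0// mulr_ge0// sqr_ge0.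
  have e0 x : 0 <= (24 * th ^+ 4)%:E * (expR (2 * y x) + expR (- (2 * y x)))%:E.
    rewrite -EFinM lee_fin mulr_ge0 ?addr_ge0 ?expR_ge0// mulr_ge0// exprn_ge0//.
    exact: ltW.
  rewrite -ge0_integralD//.
  apply: ge0_le_integral => //.
  - exact: mexp.
  - exact: emeasurable_funD.
  - move=> x _; rewrite -EFinM -EFinD lee_fin (le_trans (cosh_upper_bound _))// exprMn.
    rewrite lerD2l exprMn -/(y x) [leRHS](_ : _ = (th ^+ 4 *
      (24 * (expR (2 * y x) + expR (- (2 * y x)))))%R); last by ring.
    rewrite -mulrA ler_wpM2l ?exprn_ge0 ?(ltW th0)//.
    have yn : (expR `|th * y x| <= expR `|y x|)%R.
      by rewrite ler_expR normrM ler_piMl// gtr0_norm.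
    have := @expr_le_expR R 4 `|y x|%R (normr_ge0 _).
    have -> : (`|y x| ^+ 4 = y x ^+ 4)%R by rewrite -normrX ger0_norm// exprn_even_ge0.
    rewrite (_ : 4`!%:R = 24%R) => [y4|]; last by rewrite !factE.
    rewrite (le_trans (ler_pM _ _ y4 yn)) ?exprn_even_ge0 ?expR_ge0//.
    rewrite -mulrA -expRD ler_wpM2l// -mulNr.
    have := expR_abs_le (2 * y x); rewrite normrM mulNr; apply: le_trans.
    by rewrite ler_expR ger0_norm// mulr_natl mulr2n.
have eb : (2 * expR (th ^+ 2 / 2) <= 2 + th ^+ 2 + th ^+ 4)%R.
  have th2 : (th ^+ 2 <= 1)%R by rewrite expr_le1// ltW.
  have := @expR_quadratic_bound R (th ^+ 2 / 2)%R.
  rewrite divr_ge0 ?sqr_ge0//= -[leRHS]mul1r ler_pM2r// th2 => /(_ isT).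
  move=> h; rewrite (le_trans (ler_wpM2l _ h))// le_eqVlt; apply/orP; left; apply/eqP.
  by field.
have el : (2 + th ^+ 2 <= 2 * expR (th ^+ 2 / 2))%R.
  by have := expR_ge1Dx (th ^+ 2 / 2); lra.
have t2 : (0 < th ^+ 2)%R by rewrite exprn_gt0.
have K0 : (0 <= K)%R by rewrite /K !mulr_ge0// expR_ge0.
have th4 : (th ^+ 4 = (th ^+ 2) ^+ 2)%R by rewrite -exprM.
by rewrite th4 in ub eb; exact: squeeze_around_one lb ub el eb.
Qed.

End centered_normal.

(** * Symmetries and covariance of a Gaussian vector *)

Section gaussian_vector.
Context {R : realType} {disp : measure_display} {Omega : measurableType disp}.
Variables (P : probability Omega R) (m : nat) (Z : Omega -> 'cV[R]_m) (s : R).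
Hypothesis s0 : 0 < s.
Hypothesis mZ : measurable_fun setT (Z : Omega -> borel 'cV[R]_m).
Hypothesis lawZ : forall A : 'I_m -> set R, (forall i, measurable (A i)) ->
  P [set w | forall i, A i (Z w i 0)] = (\prod_i normal_prob 0 s (A i))%E.

Let mZi i : measurable_fun setT (fun w => Z w i 0).
Proof. exact: (measurableT_comp (measurable_entry i 0) mZ). Qed.

(** Used with all signs changed to symmetrise the step, and with a single sign changed to kill the
    mixed second moments. *)
Definition flip (e : 'I_m -> bool) (z : 'cV[R]_m) : 'cV[R]_m :=
  \col_i ((-1) ^+ e i * z i 0).

Lemma measurable_flip e :
  measurable_fun setT (flip e : borel 'cV[R]_m -> borel 'cV[R]_m).
Proof.
apply: measurable_mx => i j; under eq_fun do rewrite mxE.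
by apply: measurable_funM => //; exact: measurable_entry.
Qed.

(** It suffices to compare boxes, where the law is a product of symmetric laws on the line. *)
Lemma gaussian_flip_law e (B : set (borel 'cV[R]_m)) : measurable B ->
  P ((flip e \o Z) @^-1` B) = P (Z @^-1` B).
Proof.
pose Z1 : {mfun Omega >-> borel 'cV[R]_m} := HB.pack (Z : Omega -> borel 'cV[R]_m)
  (isMeasurableFun.Build _ _ _ _ (Z : Omega -> borel 'cV[R]_m) mZ).
pose Z2f : Omega -> borel 'cV[R]_m := flip e \o Z.
have mZ2 : measurable_fun setT Z2f := measurableT_comp (measurable_flip e) mZ.
pose Z2 : {mfun Omega >-> borel 'cV[R]_m} := HB.pack Z2f
  (isMeasurableFun.Build _ _ _ _ Z2f mZ2).
apply: (@eq_measure_boxes _ _ (distribution P Z2) (distribution P Z1)).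
  by apply: le_lt_trans (ltry 1); exact: probability_le1.
move=> A mA.
pose A' i : set R := if e i then -%R @^-1` A i else A i.
have mA' i : measurable (A' i).
  rewrite /A'; case: (e i) => //; rewrite -[X in measurable X]setTI.
  by have /(_ measurableT _ (mA i)) := @oppr_measurable R setT.
transitivity (P [set w | forall i, A' i (Z w i 0)]).
  congr (P _); apply/seteqP; split => w /= h i; have := h i; rewrite /A' ?mxE;
    case: (e i); rewrite ?expr0 ?mul1r ?expr1 ?mulN1r//.
rewrite lawZ// [RHS]lawZ//; apply: eq_bigr => i _.
by rewrite /A'; case: (e i) => //; exact: normal_probN.
Qed.

Lemma ge0_integral_gaussian_flip e (f : 'cV[R]_m -> \bar R) :
  measurable_fun setT (f : borel 'cV[R]_m -> \bar R) ->
  (forall z, (0 <= f z)%E) ->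
  (\int[P]_w f (flip e (Z w)) = \int[P]_w f (Z w))%E.
Proof.
move=> mf f0.
have mZ2 : measurable_fun setT (flip e \o Z : Omega -> borel 'cV[R]_m) :=
  measurableT_comp (measurable_flip e) mZ.
transitivity (\int[pushforward P (flip e \o Z : Omega -> borel 'cV[R]_m)]_z f z)%E.
  by rewrite ge0_integral_pushforward.
transitivity (\int[pushforward P (Z : Omega -> borel 'cV[R]_m)]_z f z)%E.
  by apply: eq_measure_integral => B mB _; exact: gaussian_flip_law.
by rewrite ge0_integral_pushforward.
Qed.

(** The law of one coordinate is read off the boxes whose other sides are [setT]. *)
Lemma ge0_integral_gaussian_entry i (f : R -> \bar R) :
  measurable_fun setT f -> (forall x, (0 <= f x)%E) ->
  (\int[P]_w f (Z w i 0%R) = \int[normal_prob 0 s]_x f x)%E.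
Proof.
move=> mf f0.
pose Zi : Omega -> measurableTypeR R := fun w => Z w i 0.
have mZi' : measurable_fun setT Zi := mZi i.
pose X : {mfun Omega >-> measurableTypeR R} :=
  HB.pack Zi (isMeasurableFun.Build _ _ _ _ Zi mZi').
rewrite -[LHS](@ge0_integral_distribution _ _ _ (measurableTypeR R) _ P X f)//.
apply: (@eq_measure_integral _ (measurableTypeR R) R setT (normal_prob 0 s)
  (distribution P X) f) => B mB _.
pose A j := if j == i then B else setT.
have mA j : measurable (A j) by rewrite /A; case: ifP.
transitivity (P [set w | forall j, A j (Z w j 0)]).
  congr (P _); apply/seteqP; split => w /=; rewrite /A.
    by move=> Bw j; case: eqP => [->|].
  by move=> /(_ i); rewrite eqxx.
rewrite lawZ// (bigD1 i)//= big1 ?mule1; first by rewrite /A eqxx.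
move=> j ji; rewrite /A (negbTE ji); exact: (@probability_setT _ _ _ (normal_prob (0 : R) s)).
Qed.

Lemma integral_gaussian_square i : (\int[P]_w (Z w i 0 ^+ 2)%:E = (s ^+ 2)%:E)%E.
Proof.
rewrite (@ge0_integral_gaussian_entry i (fun x => (x ^+ 2)%:E)).
- exact: normal_second_moment.
- by apply/measurable_EFinP; exact: measurable_funX.
- by move=> x; rewrite lee_fin sqr_ge0.
Qed.

Lemma integrable_gaussian_mul i j :
  P.-integrable setT (fun w => (Z w i 0 * Z w j 0)%:E).
Proof.
have sq k : P.-integrable setT (fun w => (Z w k 0 ^+ 2)%:E).
  apply/integrableP; split; first by apply/measurable_EFinP; exact: measurable_funX.
  under eq_integral do rewrite gee0_abs ?lee_fin ?sqr_ge0//.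
  by rewrite integral_gaussian_square ltry.
apply: (le_integrable _ _ _ (integrableD _ (sq i) (sq j))) => //.
  by apply/measurable_EFinP; exact: measurable_funM.
move=> w _; rewrite -EFinD !abse_EFin lee_fin [leRHS]ger0_norm ?addr_ge0 ?sqr_ge0//.
rewrite normrM -(real_normK (num_real (Z w i 0))) -(real_normK (num_real (Z w j 0))).
have := sqr_ge0 (`|Z w i 0| - `|Z w j 0|).
have := sqr_ge0 (`|Z w i 0| + `|Z w j 0|); nra.
Qed.

(** For i distinct from j, changing the sign of coordinate i alone preserves the law and negates the
    product; its mean is finite and equal to its opposite, hence 0. *)
Lemma integral_gaussian_mul i j :
  (\int[P]_w (Z w i 0 * Z w j 0)%:E = ((i == j)%:R * s ^+ 2)%:E)%E.
Proof.
have [<-|ij] := eqVneq i j.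
  by rewrite mul1r -(integral_gaussian_square i); apply: eq_integral => w _; rewrite expr2.
rewrite mul0r.
pose e k := k == i.
have mf : measurable_fun setT (fun z : borel 'cV[R]_m => (z i 0 * z j 0)%:E).
  by apply/measurable_EFinP; apply: measurable_funM; exact: measurable_entry.
have mZ2 : measurable_fun setT (flip e \o Z : Omega -> borel 'cV[R]_m) :=
  measurableT_comp (measurable_flip e) mZ.
have intN : P.-integrable setT (fun w => (- (Z w i 0 * Z w j 0))%:E).
  exact: (integrableN (integrable_gaussian_mul i j)).
have flipE w : (flip e (Z w) i 0 * flip e (Z w) j 0 = - (Z w i 0 * Z w j 0)).
  by rewrite !mxE /e eqxx eq_sym (negbTE ij) expr1 expr0; ring.
have : (\int[P]_w (Z w i 0%R * Z w j 0%R)%:E = \int[P]_w (- (Z w i 0%R * Z w j 0%R))%:E)%E.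
  transitivity (\int[pushforward P (Z : Omega -> borel 'cV[R]_m)]_z (z i 0 * z j 0)%:E)%E.
    by rewrite integral_pushforward//; exact: integrable_gaussian_mul.
  transitivity (\int[pushforward P (flip e \o Z : Omega -> borel 'cV[R]_m)]_z
      (z i 0 * z j 0)%:E)%E.
    by apply: eq_measure_integral => B mB _; apply/esym; exact: gaussian_flip_law.
  rewrite integral_pushforward//=; first by apply: eq_integral => w _; rewrite /= flipE.
  rewrite (_ : _ \o _ = (fun w => (- (Z w i 0 * Z w j 0))%:E))//.
  by apply/funext => w /=; rewrite flipE.
under [RHS]eq_integral do rewrite EFinN.
rewrite integralN; last first.
  exact: (integrable_add_def measurableT (integrable_gaussian_mul i j)).
have := integrable_fin_num measurableT (integrable_gaussian_mul i j).
case: (\int[P]_w _)%E => //= r _ [] rN; congr (_%:E); lra.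
Qed.

Lemma gaussian_moment_bound n i :
  (\int[P]_w ((`|Z w i 0| / s) ^+ n)%:E <= (n`!%:R * (2 * expR (1 / 2)))%:E)%E.
Proof.
rewrite (@ge0_integral_gaussian_entry i (fun x => ((`|x| / s) ^+ n)%:E)).
- exact: normal_moment_bound.
- by apply/measurable_EFinP; apply: measurable_funX; exact: measurable_funM.
- by move=> x; rewrite lee_fin exprn_ge0// divr_ge0// ltW.
Qed.

End gaussian_vector.

(** * Quadratic forms and radial moments of a Gaussian vector *)

Section gaussian_forms.
Context {R : realType} {disp : measure_display} {Omega : measurableType disp}.
Variables (P : probability Omega R) (m : nat) (Z : Omega -> 'cV[R]_m) (s : R).
Hypothesis s0 : 0 < s.
Hypothesis mZ : measurable_fun setT (Z : Omega -> borel 'cV[R]_m).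
Hypothesis lawZ : forall A : 'I_m -> set R, (forall i, measurable (A i)) ->
  P [set w | forall i, A i (Z w i 0)] = (\prod_i normal_prob 0 s (A i))%E.

Let term (c : 'I_m -> 'I_m -> R) k l w := ((c k l)%:E * (Z w k 0%R * Z w l 0%R)%R%:E)%E.

Let integrable_term c k l : P.-integrable setT (term c k l).
Proof.
exact: (integrableZl measurableT _ (integrable_gaussian_mul s0 mZ lawZ k l)).
Qed.

Let formE (c : 'I_m -> 'I_m -> R) :
  (fun w => (\sum_k \sum_l c k l * (Z w k 0 * Z w l 0))%:E) =
  (fun w => \sum_k \sum_l term c k l w)%E.
Proof.
apply/funext => w; rewrite -sumEFin; apply: eq_bigr => k _.
by rewrite -sumEFin; apply: eq_bigr => l _; rewrite EFinM.
Qed.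

Lemma integrable_gaussian_form (c : 'I_m -> 'I_m -> R) :
  P.-integrable setT (fun w => (\sum_k \sum_l c k l * (Z w k 0 * Z w l 0))%:E).
Proof.
rewrite formE; apply: integrable_sum => // k _; exact: integrable_sum.
Qed.

Lemma integral_gaussian_form (c : 'I_m -> 'I_m -> R) :
  (\int[P]_w (\sum_k \sum_l c k l * (Z w k 0%R * Z w l 0%R))%R%:E =
   (s ^+ 2 * \sum_k c k k)%R%:E)%E.
Proof.
rewrite (_ : (fun w => _) = (fun w => \sum_k \sum_l term c k l w)%E); last exact: formE.
rewrite integral_sum//; last by move=> k; exact: integrable_sum.
rewrite mulr_sumr -sumEFin; apply: eq_bigr => k _.
rewrite integral_sum// (bigD1 k)//= big1 ?addr0 => [|l lk].
  rewrite /term integralZl//; last exact: (integrable_gaussian_mul s0 mZ lawZ).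
  by rewrite (integral_gaussian_mul s0 mZ lawZ) eqxx mul1r -EFinM mulrC.
rewrite /term integralZl//; last exact: (integrable_gaussian_mul s0 mZ lawZ).
by rewrite (integral_gaussian_mul s0 mZ lawZ) eq_sym (negbTE lk) mul0r mule0.
Qed.

(** With M the maximum of 1 and the y j, the base is at most (size + 1) M, while M^N is one of the
    summands 1, y j^N. *)
Lemma sum_pow_bound (N : nat) (I : Type) (r : seq I) (y : I -> R) :
  (forall j, 0 <= y j) ->
  (1 + \sum_(j <- r) y j) ^+ N <=
    (size r).+1%:R ^+ N * (1 + \sum_(j <- r) y j ^+ N).
Proof.
move=> y0.
suff [M [M1 yM MN]] : exists M, [/\ 1 <= M,
    \sum_(j <- r) y j <= (size r)%:R * M & M ^+ N <= 1 + \sum_(j <- r) y j ^+ N].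
  rewrite (le_trans _ (ler_wpM2l _ MN)) ?exprn_ge0// -exprMn lerXn2r// ?nnegrE.
  - by rewrite addr_ge0// sumr_ge0.
  - by rewrite mulr_ge0// (le_trans ler01).
  - by rewrite -nat1r mulrDl mul1r lerD.
elim: r => [|j r [M [M1 yM MN]]].
  by exists 1; rewrite !big_nil mul0r addr0 expr1n.
exists (Num.max M (y j)); split; rewrite ?big_cons.
- by rewrite le_max M1.
- rewrite /= -nat1r mulrDl mul1r lerD ?le_max ?lexx ?orbT//.
  by rewrite (le_trans yM)// ler_wpM2l// le_max lexx.
- have S0 : 0 <= \sum_(j <- r) y j ^+ N by rewrite sumr_ge0// => i _; rewrite exprn_ge0.
  have yN : 0 <= y j ^+ N by rewrite exprn_ge0.
  by have [_|_] := leP M (y j); lra.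
Qed.

Lemma gaussian_radius_moment (N : nat) :
  (\int[P]_w ((1 + \sum_j `|Z w j 0%R| / s) ^+ N)%R%:E <=
   (m.+1%:R ^+ N * (1 + m%:R * (N`!%:R * (2 * expR (1 / 2)))))%R%:E)%E.
Proof.
have mZi i : measurable_fun setT (fun w => Z w i 0).
  exact: (measurableT_comp (measurable_entry i 0) mZ).
have my j : measurable_fun setT (fun w => `|Z w j 0| / s).
  by apply: measurable_funM => //; exact: measurableT_comp.
have y0 w j : 0 <= `|Z w j 0| / s by rewrite divr_ge0// ltW.
have mS n : measurable_fun setT (fun w => \sum_j (`|Z w j 0| / s) ^+ n).
  by apply: measurable_sum => j; exact: measurable_funX.
apply: (@le_trans _ _ (\int[P]_w ((m.+1%:R ^+ N)%R%:E *
    (1 + (\sum_j ((`|Z w j 0%R| / s) ^+ N)%R%:E)%E)))%E).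
  apply: ge0_le_integral => //.
  - by move=> w _; rewrite lee_fin exprn_ge0// addr_ge0// sumr_ge0.
  - apply/measurable_EFinP; apply: measurable_funX; apply: measurable_funD => //.
    exact: (mS 1%N).
  - apply: measurable_funeM; apply: emeasurable_funD => //.
    under eq_fun do rewrite sumEFin.
    by apply/measurable_EFinP; exact: mS.
  - move=> w _; rewrite sumEFin -EFinD -EFinM lee_fin.
    by have := sum_pow_bound N (index_enum 'I_m) (y0 w); rewrite /index_enum -enumT size_enum_ord.
have t0 w j : (0 <= ((`|Z w j 0%R| / s) ^+ N)%R%:E)%E by rewrite lee_fin exprn_ge0.
have mt j : measurable_fun setT (fun w => ((`|Z w j 0| / s) ^+ N)%:E).
  by apply/measurable_EFinP; exact: measurable_funX.
rewrite ge0_integralZl//; last 2 first.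
- apply: emeasurable_funD => //; exact: emeasurable_sum.
- by move=> w _; rewrite adde_ge0// sume_ge0.
rewrite EFinM lee_pmul2l ?lte_fin ?exprn_gt0//.
rewrite ge0_integralD//; [|by move=> w _; exact: sume_ge0|exact: emeasurable_sum].
rewrite integral_cst//= (@probability_setT _ _ _ P) mule1 EFinD leeD2l//.
rewrite ge0_integral_sum// mulr_natl -[X in _ *+ X]card_ord -sumr_const -sumEFin.
by apply: lee_sum => j _; exact: gaussian_moment_bound.
Qed.

End gaussian_forms.

(** * The scheme *)

Section one_step_mean.
Variables (R : realType) (d m p : nat) (gamma mu : R) (V : 'cV[R]_d -> R).
Hypotheses (hp : (2 <= p)%N) (hgamma : 0 < gamma <= p%:R^-1).
Hypotheses (hV : lyapunov_class p gamma V) (hmu : 0 < mu).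

Let q := minn p 4.

Lemma entry_le_hs_norm (k l : nat) (A : 'M[R]_(k, l)) i j : `|A i j| <= hs_norm A.
Proof.
rewrite -sqrtr_sqr ler_wsqrtr// (bigD1 i)//= (bigD1 j)//=.
by rewrite -addrA lerDl addr_ge0// ?sumr_ge0// => *; rewrite ?sumr_ge0// => *; exact: sqr_ge0.
Qed.

Let continuousV : continuous V.
Proof. by have [CV _ _ _] := hV; have [] := CV [::] isT. Qed.

Let V_ge0 x : 0 <= V x. Proof. by have [_] := hV. Qed.

Lemma flip_all (k : nat) (z : 'cV[R]_k) : flip (fun=> true) z = - z.
Proof. by apply/matrixP => i j; rewrite !mxE expr1 mulN1r (ord1 j). Qed.

(** The entry (l, k) of s^T V''(x) s. The order of derivation is the one produced by [nested], so
    the symmetry of second derivatives is never invoked. *)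
Let quad (s : 'M[R]_(d, m)) x k l : R :=
  \sum_i s i k * \sum_j s j l * partials V [:: j; i] x.

Lemma nested_mulmx (s : 'M[R]_(d, m)) (z : 'cV[R]_m) x :
  nested V 2 [::] (s *m z) x = \sum_k \sum_l quad s x k l * (z k 0 * z l 0).
Proof.
transitivity (\sum_i \sum_j \sum_k \sum_l
    (s i k * (s j l * partials V [:: j; i] x)) * (z k 0 * z l 0)).
  apply: eq_bigr => i _; rewrite mulr_sumr; apply: eq_bigr => j _.
  rewrite mxE [in X in _ * X]mulrC /= !mxE mulrCA !mulr_suml.
  rewrite mulr_sumr; apply: eq_bigr => k _.
  by rewrite mulr_sumr mulr_sumr; apply: eq_bigr => l _; ring.
under eq_bigr do rewrite exchange_big/=.
rewrite exchange_big/=; apply: eq_bigr => k _.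
under eq_bigr do rewrite exchange_big/=.
rewrite exchange_big/=; apply: eq_bigr => l _.
rewrite /quad mulr_suml; apply: eq_bigr => i _.
by rewrite mulr_sumr mulr_suml; apply: eq_bigr => j _ /=; ring.
Qed.

Lemma trace_quad (s : 'M[R]_(d, m)) x :
  \sum_k quad s x k k = \tr (hessian V x *m s *m s^T).
Proof.
rewrite /mxtrace -mulmxA.
under [RHS]eq_bigr => i _.
  rewrite mxE; under eq_bigr => j _ do rewrite !mxE mulr_sumr.
  over.
rewrite [RHS]exchange_big/= /quad.
rewrite exchange_big/=; apply: eq_bigr => i _.
under [LHS]eq_bigr do rewrite mulr_sumr.
rewrite exchange_big/=; apply: eq_bigr => j _; apply: eq_bigr => k _.
by rewrite !mxE; ring.
Qed.

(** C precedes the probability space, the step size, the starting point and the coefficient values,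
    which gives the uniformity required of the final constant. *)
Lemma one_step_mean : exists2 C : R, 0 <= C &
  forall (disp : measure_display) (Omega : measurableType disp)
    (P : probability Omega R) (Z : Omega -> 'cV[R]_m) (h beta1 beta2 : R)
    (x b : 'cV[R]_d) (s : 'M[R]_(d, m)),
  0 < h <= 1 -> beta1 <= 2^-1 -> beta2 <= 2^-1 - q%:R^-1 ->
  measurable_fun setT (Z : Omega -> borel 'cV[R]_m) ->
  (forall A : 'I_m -> set R, (forall i, measurable (A i)) ->
    P [set w | forall i, A i (Z w i 0)] =
    (\prod_i normal_prob 0 (Num.sqrt h) (A i))%E) ->
  hs_norm b * h `^ beta1 <= mu * (1 + V x) `^ gamma ->
  hs_norm s * h `^ beta2 <= mu * (1 + V x) `^ gamma ->
  (\int[P]_w (V (x + h *: b + s *m Z w))%:E <=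
   (V x + h * (\sum_i gradient V x i 0 * b i 0 +
      2^-1 * \tr (hessian V x *m s *m s^T)) + C * h * (1 + V x))%R%:E)%E.
Proof.
have q24 : (2 <= q <= 4)%N by rewrite /q; lia.
have qp : (q <= p)%N by exact: geq_minl.
have [C0 [N [C00 hC0]]] := one_step_expansion hgamma hV q24 qp (ltW hmu).
pose M : R := m.+1%:R ^+ N * (1 + m%:R * (N`!%:R * (2 * expR (1 / 2)))).
have M0 : 0 <= M.
  by rewrite mulr_ge0 ?exprn_ge0// addr_ge0// !mulr_ge0// expR_ge0.
(* M bounds the mean of (1 + kappa)^N; the half appears because the symmetrised expansion estimates
   twice the mean. *)
exists (C0 * M / 2); first by rewrite divr_ge0// mulr_ge0.
move=> disp Omega P Z h beta1 beta2 x b s /andP[h0 h1] hb1 hb2 mZ lawZ bB sB.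
set L := (1 + V x) `^ gamma in bB sB hC0 *.
have L0 : 0 <= L by exact: powR_ge0.
have q0 : (0 < q)%N by case/andP: q24 => q2 _; exact: leq_trans q2.
have qR0 : q%:R != 0 :> R by rewrite pnatr_eq0 -lt0n.
pose a := h `^ 2^-1; pose e := h `^ q%:R^-1.
have a0 : 0 < a by exact: powR_gt0.
have e0 : 0 < e by exact: powR_gt0.
have sqrth : Num.sqrt h = a by rewrite /a powR12_sqrt// ltW.
have powR_le1 (r : R) : 0 <= r -> h `^ r <= 1.
  by move=> r0; rewrite -(powRr0 h) ger_powR// h0 h1.
have aE : a ^+ 2 = h by rewrite -sqrth sqr_sqrtr// ltW.
have eE : e ^+ q = h by rewrite -powR_mulrn ?powR_ge0// -powRrM mulVf// powRr1// ltW.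
pose v (z : 'cV[R]_m) : 'cV[R]_d := s *m z.
(* The l1 norm of the increment in units of its standard deviation a. *)
pose kappa (z : 'cV[R]_m) := \sum_j `|z j 0| / a.
have kappa0 z : 0 <= kappa z by apply: sumr_ge0 => j _; rewrite divr_ge0// ltW.
have wB i : `|(h *: b) i 0| <= mu * a * L.
  rewrite mxE normrM gtr0_norm// [leLHS](_ : _ = a * (a * `|b i 0|)); last first.
    by rewrite mulrA -expr2 aE.
  rewrite [leRHS](_ : _ = a * (mu * L)); last by ring.
  rewrite ler_wpM2l ?(ltW a0)//.
  rewrite (le_trans _ bB)// mulrC ler_pM ?(ltW a0) ?entry_le_hs_norm//.
  by rewrite /a ger_powR// h0 h1.
(* Since h <= 1, the condition beta2 + 1/q <= 1/2 says that h^(1/2) <= h^beta2 e. *)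
have vB z i : `|v z i 0| <= mu * e * kappa z * L.
  rewrite mxE (le_trans (ler_norm_sum _ _ _))// /kappa mulr_sumr mulr_suml.
  apply: ler_sum => j _; rewrite normrM.
  have sa : `|s i j| * a <= mu * e * L.
    apply: (@le_trans _ _ (hs_norm s * (h `^ beta2 * e))).
      rewrite ler_pM ?(ltW a0) ?entry_le_hs_norm//.
      rewrite /e -powRD; last by rewrite (gt_eqF h0) implybT.
      by rewrite /a ger_powR ?h0 ?h1//; lra.
    by rewrite mulrA [mu * e * L]mulrAC ler_wpM2r// ltW.
  rewrite [leRHS](_ : _ = (mu * e * L) * (`|z j 0| / a)); last by ring.
  rewrite [leLHS](_ : _ = (`|s i j| * a) * (`|z j 0| / a)); last by field; rewrite gt_eqF.
  by rewrite ler_wpM2r// divr_ge0// ltW.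
(* For q = 3, a <= e and e^3 = h; for q = 4, a = e^2 and e^4 = h. *)
have ae : (2 < q)%N -> a * e ^+ 2 <= h.
  have q34 n : (2 <= n <= 4)%N -> (2 < n)%N -> n = 3%N \/ n = 4%N.
    by case: n => [|[|[|[|[|]]]]] //; auto.
  move=> /(q34 _ q24)[qE|q4].
    rewrite -[leRHS]eE [in leRHS]qE [in leRHS]exprS ler_wpM2r ?exprn_ge0 ?(ltW e0)// /a /e qE.
    by rewrite ger_powR ?h0 ?h1// lef_pV2 ?posrE// ler_nat.
  have -> : a = e ^+ 2.
    by rewrite -powR_mulrn ?powR_ge0// -powRrM /a q4; congr (_ `^ _); field.
  by rewrite -exprD -[leLHS]/(e ^+ 4) -q4 eE.
pose c := 2 * V x + 2 * nested V 1 [::] (h *: b) x.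
have main z : V (x + h *: b + v z) + V (x + h *: b - v z) <=
    c + nested V 2 [::] (v z) x + C0 * h * (1 + V x) * (1 + kappa z) ^+ N.
  apply: (hC0 _ _ _ _ a e) => //.
  - by rewrite (ltW a0) powR_le1.
  - by rewrite (ltW e0) powR_le1 // invr_ge0.
  - by rewrite aE.
  - by rewrite eE.
have mV (g : Omega -> 'cV[R]_d) : (forall i, measurable_fun setT (fun w => g w i 0)) ->
    measurable_fun setT (fun w => (V (g w))%:E).
  move=> mg; apply/measurable_EFinP.
  apply: (measurableT_comp (continuous_borel_measurable continuousV)).
  by apply: measurable_mx => i j; rewrite (ord1 j).
have mZi j : measurable_fun setT (fun w => Z w j 0).
  exact: (measurableT_comp (measurable_entry j 0) mZ).
have mv i : measurable_fun setT (fun w => v (Z w) i 0).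
  under eq_fun do rewrite mxE.
  by apply: measurable_sum => j; exact: measurable_funM.
have mVp : measurable_fun setT (fun w => (V (x + h *: b + v (Z w)))%:E).
  apply: mV => i; under eq_fun do rewrite mxE.
  exact: measurable_funD.
have mVm : measurable_fun setT (fun w => (V (x + h *: b - v (Z w)))%:E).
  apply: mV => i; under eq_fun do rewrite mxE [X in _ + X]mxE.
  exact: measurable_funB.
have symV : (\int[P]_w (V (x + h *: b - v (Z w)))%:E =
    \int[P]_w (V (x + h *: b + v (Z w)))%:E)%E.
  rewrite -(@ge0_integral_gaussian_flip _ _ _ P m Z a _ _ _ (fun=> true)
    (fun z => (V (x + h *: b + v z))%:E)).
  - by apply: eq_integral => w _; rewrite flip_all /v mulmxN.
  - by rewrite -sqrth sqrtr_gt0.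
  - exact: mZ.
  - by move=> A mA; rewrite -sqrth lawZ.
  - apply/measurable_EFinP.
    apply: (measurableT_comp (continuous_borel_measurable continuousV)).
    apply: measurable_mx => i j; rewrite (ord1 j).
    under eq_fun do rewrite mxE [X in _ + X]mxE.
    apply: measurable_funD => //; apply: measurable_sum => k.
    by apply: measurable_funM => //; exact: measurable_entry.
  - by move=> z; rewrite lee_fin.
have lawa (A : 'I_m -> set R) : (forall i, measurable (A i)) ->
    P [set w | forall i, A i (Z w i 0)] = (\prod_i normal_prob 0 a (A i))%E.
  by move=> mA; rewrite -sqrth lawZ.
have iform := integrable_gaussian_form a0 mZ lawa (quad s x).
have mk : measurable_fun setT (fun w => ((1 + kappa (Z w)) ^+ N)%:E).
  apply/measurable_EFinP; apply: measurable_funX; apply: measurable_funD => //.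
  apply: measurable_sum => j; apply: measurable_funM => //.
  exact: measurableT_comp.
have k0 w : 0 <= (1 + kappa (Z w)) ^+ N by rewrite exprn_ge0// addr_ge0.
have kM := gaussian_radius_moment a0 mZ lawa N; rewrite -/M in kM.
have ik : P.-integrable setT (fun w => ((1 + kappa (Z w)) ^+ N)%:E).
  apply/integrableP; split=> //.
  under eq_integral do rewrite gee0_abs ?lee_fin//.
  exact: le_lt_trans kM (ltry _).
have twice : (\int[P]_w (V (x + h *: b + v (Z w)))%:E +
    \int[P]_w (V (x + h *: b + v (Z w)))%:E <=
    (c + h * \sum_k quad s x k k + C0 * h * (1 + V x) * M)%:E)%E.
  rewrite -{2}symV -ge0_integralD//; try by move=> w _; rewrite lee_fin.
  pose D := C0 * h * (1 + V x).
  have D0 : 0 <= D by rewrite !mulr_ge0 ?addr_ge0// ltW.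
  have ic : P.-integrable setT (fun w : Omega => c%:E).
    exact: finite_measure_integrable_cst.
  have iD : P.-integrable setT (fun w => D%:E * ((1 + kappa (Z w)) ^+ N)%:E)%E.
    exact: integrableZl.
  pose rhs w := (c%:E + (\sum_k \sum_l quad s x k l * (Z w k 0%R * Z w l 0%R))%R%:E +
      D%:E * ((1 + kappa (Z w)) ^+ N)%R%:E)%E.
  have irhs : P.-integrable setT rhs.
    by apply: integrableD => //; apply: integrableD.
  apply: (@le_trans _ _ (\int[P]_w rhs w)%E).
    apply: ge0_le_integral => //.
    - by move=> w _; rewrite -EFinD lee_fin addr_ge0.
    - exact: emeasurable_funD.
    - exact: measurable_int irhs.
    - by move=> w _; rewrite /rhs -nested_mulmx -EFinM -!EFinD lee_fin main.
  rewrite integralD//; last exact: integrableD.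
  rewrite integralD// integralZl// (integral_gaussian_form a0 mZ lawa) aE.
  rewrite integral_cst//= (@probability_setT _ _ _ P) mule1 -EFinD [leRHS]EFinD leeD2l//.
  by rewrite -/D [leRHS]EFinM lee_wpmul2l ?lee_fin.
have cE : nested V 1 [::] (h *: b) x = h * \sum_i gradient V x i 0 * b i 0.
  by rewrite mulr_sumr; apply: eq_bigr => i _; rewrite !mxE mulrAC -mulrA.
move: twice; rewrite trace_quad /c cE.
(* Nonnegativity excludes [-oo] and the bound on the doubled integral excludes [+oo], so the
   inequality can be halved among real numbers. *)
have : (0 <= \int[P]_w (V (x + h *: b + v (Z w)))%:E)%E.
  by apply: integral_ge0 => w _; rewrite lee_fin.
case: (\int[P]_w _)%E => [r| |] //.
rewrite -EFinD !lee_fin => _ rr.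
set A := \sum_i _ in rr *; set T := \tr _ in rr *.
have -> : C0 * M / 2 * h * (1 + V x) = (C0 * h * (1 + V x) * M) / 2 by ring.
by set E := C0 * h * _ * M in rr *; lra.
Qed.

End one_step_mean.

(** * Adaptedness of the scheme and conditioning on the past *)

Section adapted_scheme.
Context {R : realType} {disp : measure_display} {Omega : measurableType disp}.

(** Makes the calculus of measurable functions available with a sigma-algebra of the filtration in
    place of the ambient one. *)
Lemma measurable_wrtP (G : set (set Omega)) (T : ptopologicalType) (X : Omega -> T) :
  sigma_algebra setT G ->
  measurable_wrt G X <->
  measurable_fun setT (X : g_sigma_algebraType G -> borel T).
Proof.
move=> sG; have GE : @measurable _ (g_sigma_algebraType G) = G.
  exact: sigma_algebra_id.
split=> [GX _ B mB|mX B mB]; first by rewrite setTI GE; exact: GX.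
by have := mX measurableT B mB; rewrite setTI GE.
Qed.

Lemma coef_measurable_section (d : nat) (T t : R) (U : ptopologicalType)
    (f : R -> 'cV[R]_d -> U) :
  0 <= t <= T -> coef_measurable T f ->
  measurable_fun setT (f t : borel 'cV[R]_d -> borel U).
Proof.
move=> tT mf _ Y mY; rewrite setTI.
have mD : measurable ([set z | 0 <= z.1 <= T] : set (R * borel 'cV[R]_d)).
  have -> : ([set z | 0 <= z.1 <= T] : set (R * borel 'cV[R]_d)) =
      setT `&` fst @^-1` [set` `[0, T]].
    by rewrite setTI; apply/seteqP; split => z /=; rewrite in_itv.
  exact: measurable_fst.
have mpair : measurable_fun setT (fun x : borel 'cV[R]_d => (t, x)).
  exact: measurable_fun_pair.
have := mpair measurableT _ (mf mD Y mY); rewrite setTI.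
rewrite (_ : _ @^-1` _ = f t @^-1` Y)//.
by apply/seteqP; split => x /=; [case|move=> Yx; split].
Qed.

(** Adaptedness at the grid times is what makes the next increment independent of the current
    position. The coefficients are measurable on [0, T] only, whence the restriction on k. *)
Lemma tamed_scheme_measurable (d m : nat) (b : R -> 'cV[R]_d -> 'cV[R]_d)
    (sigma : R -> 'cV[R]_d -> 'M[R]_(d, m)) (T h : R)
    (F : R -> set (set Omega)) (W : R -> Omega -> 'cV[R]_m) (X0 : Omega -> 'cV[R]_d) :
  0 < h -> filtration F -> (forall t, 0 <= t -> measurable_wrt (F t) (W t)) ->
  measurable_wrt (F 0) X0 -> coef_measurable T b -> coef_measurable T sigma ->
  forall k, k%:R * h <= T ->
  measurable_wrt (F (k%:R * h)) (tamed_scheme b sigma h W X0 k).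
Proof.
move=> h0 [sF _ Fmono] mW mX0 mb ms; elim=> [_|k IHk kT]; first by rewrite mul0r.
have kh0 j : 0 <= j%:R * h by rewrite mulr_ge0// ltW.
have kk1 : k%:R * h <= k.+1%:R * h by rewrite ler_pM2r// ler_nat.
have kT' : k%:R * h <= T by exact: le_trans kk1 kT.
have kT01 : 0 <= k%:R * h <= T by rewrite kh0.
set G := F (k.+1%:R * h).
have sG : sigma_algebra setT G by exact: sF.
apply/measurable_wrtP => //.
have mX : measurable_fun setT
    (tamed_scheme b sigma h W X0 k : g_sigma_algebraType G -> borel 'cV[R]_d).
  apply/measurable_wrtP => // B mB; apply: (Fmono (k%:R * h)) => //.
  exact: IHk.
have mXi i : measurable_fun setT
    (fun w : g_sigma_algebraType G => tamed_scheme b sigma h W X0 k w i 0).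
  exact: (measurableT_comp (measurable_entry i 0) mX).
have mbi i : measurable_fun setT (fun w : g_sigma_algebraType G =>
    b (k%:R * h) (tamed_scheme b sigma h W X0 k w) i 0).
  apply: (measurableT_comp (measurable_entry i 0)).
  exact: (measurableT_comp (coef_measurable_section kT01 mb) mX).
have msi i j : measurable_fun setT (fun w : g_sigma_algebraType G =>
    sigma (k%:R * h) (tamed_scheme b sigma h W X0 k w) i j).
  apply: (measurableT_comp (measurable_entry i j)).
  exact: (measurableT_comp (coef_measurable_section kT01 ms) mX).
have mWi t j : 0 <= t <= k.+1%:R * h ->
    measurable_fun setT (fun w : g_sigma_algebraType G => W t w j 0).
  move=> /andP[t0 tk]; apply: (measurableT_comp (measurable_entry j 0)).
  by apply/measurable_wrtP => // B mB; apply: (Fmono t) => //; exact: mW.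
apply: measurable_mx => i j; rewrite (ord1 j).
rewrite (_ : (fun w => _) = (fun w => tamed_scheme b sigma h W X0 k w i 0 +
   h * b (k%:R * h) (tamed_scheme b sigma h W X0 k w) i 0 +
   \sum_j sigma (k%:R * h) (tamed_scheme b sigma h W X0 k w) i j *
     (W (k.+1%:R * h) w j 0 - W (k%:R * h) w j 0))); last first.
  apply/funext => w; rewrite !mxE; congr (_ + _).
  by apply: eq_bigr => l _; rewrite !mxE.
apply: measurable_funD.
  by apply: measurable_funD => //; exact: measurable_funM.
apply: measurable_sum => l; apply: measurable_funM => //.
by apply: measurable_funB; apply: mWi; rewrite ?lexx ?kh0 ?kk1.
Qed.

(* The law of (X, Z) is the product of the laws of X and Z, so this is Tonelli. *)
Lemma independence_freezing (P : probability Omega R) (G : set (set Omega))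
    (d m : nat) (X : Omega -> 'cV[R]_d) (Z : Omega -> 'cV[R]_m)
    (f : 'cV[R]_d * 'cV[R]_m -> \bar R) :
  G `<=` measurable -> measurable_wrt G X ->
  measurable_fun setT (Z : Omega -> borel 'cV[R]_m) ->
  (forall (A : set Omega) (B : set (borel 'cV[R]_m)), G A -> measurable B ->
     (P (A `&` Z @^-1` B) = P A * P (Z @^-1` B))%E) ->
  measurable_fun setT (f : borel 'cV[R]_d * borel 'cV[R]_m -> \bar R) ->
  (forall z, (0 <= f z)%E) ->
  (\int[P]_w f (X w, Z w) = \int[P]_w \int[P]_w' f (X w, Z w'))%E.
Proof.
move=> Gm GX mZ ind mf f0.
pose Xf : Omega -> borel 'cV[R]_d := X.
pose Zf : Omega -> borel 'cV[R]_m := Z.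
have mX : measurable_fun setT Xf by move=> _ B mB; rewrite setTI; exact/Gm/GX.
pose Xm : {mfun Omega >-> borel 'cV[R]_d} :=
  HB.pack Xf (isMeasurableFun.Build _ _ _ _ Xf mX).
pose Zm : {mfun Omega >-> borel 'cV[R]_m} :=
  HB.pack Zf (isMeasurableFun.Build _ _ _ _ Zf mZ).
pose XZ : Omega -> borel 'cV[R]_d * borel 'cV[R]_m := fun w => (X w, Z w).
have mXZ : measurable_fun setT XZ by exact: measurable_fun_pair.
pose XZm : {mfun Omega >-> (borel 'cV[R]_d * borel 'cV[R]_m)%type} :=
  HB.pack XZ (isMeasurableFun.Build _ _ _ _ XZ mXZ).
have joint C : measurable C ->
    (distribution P Xm \x distribution P Zm)%E C = distribution P XZm C.
  apply: product_measure_unique => A B mA mB.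
  by rewrite -[RHS]ind//; exact: GX.
transitivity (\int[distribution P XZm]_z f z)%E.
  by rewrite ge0_integral_distribution.
transitivity (\int[(distribution P Xm \x distribution P Zm)%E]_z f z)%E.
  by apply: eq_measure_integral => C mC _; apply/esym; exact: joint.
rewrite fubini_tonelli1//.
rewrite ge0_integral_distribution//.
- apply: eq_integral => w _ /=; rewrite /fubini_F.
  rewrite ge0_integral_distribution//.
  exact: (measurableT_comp mf (measurable_fun_pair _ _)).
- exact: measurable_fun_fubini_tonelli_F.
- by move=> x; exact: integral_ge0.
Qed.

End adapted_scheme.

(** Joint measurability in position and increment, as Tonelli requires. *)
Lemma measurable_scheme_step (R : realType) (d m : nat) (V : 'cV[R]_d -> R)
    (b : 'cV[R]_d -> 'cV[R]_d) (s : 'cV[R]_d -> 'M[R]_(d, m)) (h : R) :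
  continuous V ->
  measurable_fun setT (b : borel 'cV[R]_d -> borel 'cV[R]_d) ->
  measurable_fun setT (s : borel 'cV[R]_d -> borel 'M[R]_(d, m)) ->
  measurable_fun setT (fun z : borel 'cV[R]_d * borel 'cV[R]_m =>
    (V (z.1 + h *: b z.1 + s z.1 *m z.2))).
Proof.
move=> cV mb ms.
apply: (measurableT_comp (continuous_borel_measurable cV)).
apply: measurable_mx => i j; rewrite (ord1 j).
rewrite (_ : (fun z => _) = (fun z : borel 'cV[R]_d * borel 'cV[R]_m =>
    z.1 i 0 + h * b z.1 i 0 + \sum_j s z.1 i j * z.2 j 0)); last first.
  by apply/funext => z; rewrite !mxE.
have mfst (g : borel 'cV[R]_d -> R) : measurable_fun setT g ->
    measurable_fun setT (fun z : borel 'cV[R]_d * borel 'cV[R]_m => g z.1).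
  by move=> mg; exact: (measurableT_comp mg measurable_fst).
apply: measurable_funD.
  apply: measurable_funD; first by apply: (mfst (fun x => x i 0)); exact: measurable_entry.
  apply: measurable_funM => //; apply: (mfst (fun x => b x i 0)).
  exact: (measurableT_comp (measurable_entry i 0) mb).
apply: measurable_sum => l; apply: measurable_funM.
  by apply: (mfst (fun x => s x i l)); exact: (measurableT_comp (measurable_entry i l) ms).
exact: (measurableT_comp (measurable_entry l 0) measurable_snd).
Qed.

Theorem proposition2p1 (R : realType) (d m p : nat) (gamma mu : R)
    (V : 'cV[R]_d -> R)
    (hp : (2 <= p)%N) (hgamma : 0 < gamma <= p%:R^-1)
    (hV : lyapunov_class p gamma V) (hmu : 0 < mu) :
  exists rhot : R,
  forall (T h rho beta1 beta2 : R)
    (b : R -> 'cV[R]_d -> 'cV[R]_d) (sigma : R -> 'cV[R]_d -> 'M[R]_(d, m))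
    (disp : measure_display) (Omega : measurableType disp)
    (P : probability Omega R) (F : R -> set (set Omega))
    (W : R -> Omega -> 'cV[R]_m) (X0 : Omega -> 'cV[R]_d),
  0 < T -> 0 < h <= 1 -> 0 < rho ->
  beta1 <= 2^-1 -> beta2 <= 2^-1 - (minn p 4)%:R^-1 ->
  measure_is_complete P ->
  filtration F -> right_continuous_filtration F ->
  wiener_process P F W ->
  measurable_wrt (F 0) X0 ->
  coef_measurable T b -> coef_measurable T sigma ->
  (forall t x, 0 <= t <= T -> generator b sigma V t x <= rho * V x) ->
  (forall t x, 0 <= t <= T ->
    Num.max (hs_norm (b t x) * h `^ beta1) (hs_norm (sigma t x) * h `^ beta2)
      <= mu * (1 + V x) `^ gamma) ->
  forall k : nat, k%:Z <= Num.floor (T / h) ->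
  ('E_P[fun w => V (tamed_scheme b sigma h W X0 k w)] <=
   (expR ((rho + rhot) * T))%:E * 'E_P[fun w => (1 + V (X0 w))%R])%E.
Proof.
have [C C0 hC] := one_step_mean m hp hgamma hV hmu.
exists C => T h rho beta1 beta2 b sigma disp Omega P F W X0 T0 h01 rho0 hb1 hb2.
move=> _ filF _ [mW _ _ indW lawW] mX0 mb ms hgen hbs k kT.
have /andP[h0 h1] := h01.
have [CV V0 _ _] := hV.
have cV : continuous V by have [] := CV [::] isT.
have {}kT : k%:R * h <= T.
  by rewrite -ler_pdivlMr//; move: kT; rewrite floor_ge_int.
have [sF Fm _] := filF.
pose X := tamed_scheme b sigma h W X0.
have kh0 j : 0 <= j%:R * h by rewrite mulr_ge0// ltW.
have FX j : j%:R * h <= T -> measurable_wrt (F (j%:R * h)) (X j).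
  exact: tamed_scheme_measurable.
have mX j : j%:R * h <= T -> measurable_fun setT (X j : Omega -> borel 'cV[R]_d).
  move=> jT _ B mB; rewrite setTI; apply: (Fm (j%:R * h)) => //; exact: FX.
have mVX j : j%:R * h <= T -> measurable_fun setT (fun w => V (X j w)).
  by move=> jT; exact: (measurableT_comp (continuous_borel_measurable cV) (mX j jT)).
pose r := rho + C.
have r0 : 0 <= r by rewrite addr_ge0// ltW.
(* Both sides may be [+oo]. The position at time t is frozen, the increment is integrated out, and
   the bound so obtained is integrated over the position. *)
have step j : j.+1%:R * h <= T ->
    (\int[P]_w (1 + V (X j.+1 w))%R%:E <=
     (1 + r * h)%:E * \int[P]_w (1 + V (X j w))%R%:E)%E.
  move=> jT; pose t := j%:R * h.
  have tj : t < j.+1%:R * h by rewrite ltr_pM2r// ltr_nat.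
  have tT : t <= T by rewrite (le_trans (ltW tj)).
  have t0T : 0 <= t <= T by rewrite kh0.
  have jT' : j%:R * h <= T by [].
  pose Z := increment W t (j.+1%:R * h).
  have mZ : measurable_fun setT (Z : Omega -> borel 'cV[R]_m).
    have mWi u i : 0 <= u -> measurable_fun setT (fun w => W u w i 0).
      move=> u0; apply: (measurableT_comp (measurable_entry i 0)).
      by move=> _ B mB; rewrite setTI; apply: (Fm u) => //; exact: mW.
    apply: measurable_mx => i l; rewrite (ord1 l).
    rewrite (_ : (fun w => _) = (fun w => W (j.+1%:R * h) w i 0 - W t w i 0)).
      by apply: measurable_funB; apply: mWi => //; exact: kh0.
    by apply/funext => w; rewrite !mxE.
  have lawZ (A : 'I_m -> set R) : (forall i, measurable (A i)) ->
      P [set w | forall i, A i (Z w i 0)] =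
      (\prod_i normal_prob 0 (Num.sqrt h) (A i))%E.
    move=> mA; have := lawW t (j.+1%:R * h) (kh0 j) tj A mA.
    have -> // : j.+1%:R * h - t = h.
    by rewrite /t -mulrBl -natr1 addrAC subrr add0r mul1r.
  pose f (z : 'cV[R]_d * 'cV[R]_m) : \bar R :=
    (1 + V (z.1 + h *: b t z.1 + sigma t z.1 *m z.2))%:E.
  have mf : measurable_fun setT (f : borel 'cV[R]_d * borel 'cV[R]_m -> \bar R).
    apply/measurable_EFinP; apply: measurable_funD => //.
    exact: (measurable_scheme_step h cV (coef_measurable_section t0T mb)
      (coef_measurable_section t0T ms)).
  have f0 z : (0 <= f z)%E by rewrite lee_fin addr_ge0.
  have -> : (\int[P]_w (1 + V (X j.+1 w))%R%:E = \int[P]_w \int[P]_w' f (X j w, Z w'))%E.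
    apply: (@independence_freezing _ _ _ P (F t) _ _ (X j) Z f) => //.
    - exact: (Fm t (kh0 j)).
    - exact: FX.
    - by move=> A B FA mB; exact: (indW t (j.+1%:R * h) (kh0 j) tj).
  have mfz x : measurable_fun setT (fun w => f (x, Z w)).
    exact: (measurableT_comp mf (measurable_fun_pair (measurable_cst _) mZ)).
  have inner x : (\int[P]_w f (x, Z w) <= ((1 + r * h) * (1 + V x))%R%:E)%E.
    have := hC _ _ P Z h beta1 beta2 x (b t x) (sigma t x) h01 hb1 hb2 mZ lawZ.
    have := hbs t x t0T; rewrite ge_max => /andP[hb hs] /(_ hb hs) hV1.
    rewrite /f /=; under eq_integral do rewrite EFinD.
    rewrite ge0_integralD//; last 2 first.
    - by move=> w _; rewrite lee_fin.
    - have := mfz x; rewrite /f /= => /measurable_EFinP m1; apply/measurable_EFinP.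
      rewrite (_ : (fun w => _) = (fun w => (1 + V (x + h *: b t x + sigma t x *m Z w)) - 1)).
        exact: measurable_funB.
      by apply/funext => w; rewrite [RHS]addrC addKr.
    rewrite integral_cst//= (@probability_setT _ _ _ P) mule1.
    apply: (le_trans (leeD2l _ hV1)).
    rewrite -EFinD lee_fin -/(generator b sigma V t x) /r.
    (* The generator contributes at most rho h V; adding rho h >= 0 makes it, like the error C h (1
       + V), a multiple of 1 + V. *)
    have := ler_wpM2l (ltW h0) (hgen t x t0T).
    have : 0 <= rho * h by rewrite mulr_ge0// ltW.
    set g := h * generator _ _ _ _ _; lra.
  rewrite -ge0_integralZl//.
  - apply: ge0_le_integral => //.
    + by move=> w _; exact: integral_ge0.
    + have mXm : measurable_fun setT
          (fun w : Omega => integral P setT (fun w' => f (X j w, Z w'))).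
        have mfZ : measurable_fun setT (fun z : borel 'cV[R]_d * Omega => f (z.1, Z z.2)).
          apply: (measurableT_comp mf); apply: measurable_fun_pair => //.
          exact: (measurableT_comp mZ measurable_snd).
        have mF := measurable_fun_fubini_tonelli_F (m2 := P) _ mfZ (fun z => f0 _).
        exact: (measurableT_comp mF (mX j jT')).
      exact: mXm.
    + apply: measurable_funeM; apply/measurable_EFinP.
      by apply: measurable_funD => //; exact: mVX.
  - by apply/measurable_EFinP; apply: measurable_funD => //; exact: mVX.
  - by move=> w _; rewrite lee_fin addr_ge0.
  - by rewrite lee_fin addr_ge0// mulr_ge0// ltW.
have growth j : j%:R * h <= T ->
    (\int[P]_w (1 + V (X j w))%R%:E <=
     (expR (r * (j%:R * h)))%:E * \int[P]_w (1 + V (X0 w))%R%:E)%E.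
  elim: j => [_|j IHj jT]; first by rewrite mul0r mulr0 expR0 mul1e.
  have jT' : j%:R * h <= T by rewrite (le_trans _ jT)// ler_pM2r// ler_nat.
  apply: (le_trans (step j jT)).
  have e0 : (0 <= (1 + r * h)%:E)%E by rewrite lee_fin addr_ge0// mulr_ge0// ltW.
  apply: (le_trans (lee_wpmul2l e0 (IHj jT'))).
  rewrite muleA -EFinM lee_wpmul2r//.
    by apply: integral_ge0 => w _; rewrite lee_fin addr_ge0.
  have -> : r * (j.+1%:R * h) = r * (j%:R * h) + r * h by rewrite -natr1; ring.
  rewrite lee_fin expRD mulrC ler_wpM2l ?expR_ge0//.
  exact: expR_ge1Dx.
rewrite unlock.
apply: (@le_trans _ _ (\int[P]_w (1 + V (X k w))%R%:E)%E).
  apply: ge0_le_integral => //.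
  - by move=> w _; rewrite lee_fin.
  - by apply/measurable_EFinP; exact: mVX.
  - by apply/measurable_EFinP; apply: measurable_funD => //; exact: mVX.
  - by move=> w _; rewrite lee_fin lerDr.
apply: (le_trans (growth k kT)); rewrite lee_wpmul2r//.
  by apply: integral_ge0 => w _; rewrite lee_fin addr_ge0.
by rewrite lee_fin ler_expR ler_wpM2l.
Qed.
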